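(* Let $k>1$ be an integer, and let $\beta\in(1,k)$ and $\omega>0$ be computable real numbers such that \[ \beta(1+\omega)\le k . \] Suppose Alice plays the $(\beta,\omega,k)$-game using a computable strategy, in the sense made precise below. Then there is a computable infinite path from the root of the $k$-ary tree such that Bob, following this path, wins the game against Alice's strategy, i.e., he never enters a forbidden vertex.
   Context: The $(\beta,\omega,k)$-game is an infinite game between Alice and Bob played on the infinite rooted $k$-ary tree. Bob has a current position, a vertex of the tree, which is initially the root. There is a set $F$ of forbidden vertices, initially empty, and vertices never leave $F$. The players alternate, and Alice moves first. On her move, Alice adds to $F$ some set (possibly infinite) of vertices in the subtree rooted at Bob's current position $v$. She may not forbid $v$ itself. Her move is subject to a weight restriction. A vertex of this subtree lying $d$ levels below $v$ has weight $\beta^{-d}$, measured in the current subtree. The total weight of the vertices newly forbidden in that move must not exceed $\omega$. On his move, Bob moves from his current position to one of its $k$ children. Bob loses if he ever moves into a forbidden vertex. Bob wins if he never enters a forbidden vertex. Alice's strategy is computable if there is an algorithm that, given the history of the play so far, outputs her next move as two programs: (i) a program that decides, for each vertex, whether it is newly forbidden in this move; (ii) a modulus of convergence for the total weight of the newly forbidden set, i.e., a program that, for every rational $\varepsilon>0$, returns an integer $N$ such that the total weight of the newly forbidden vertices lying more than $N$ levels below Bob's current position is less than $\varepsilon$. *)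

(* Defs.v *)
From HB Require Import structures.
From mathcomp Require Import all_boot all_order all_algebra.
From mathcomp Require Import all_classical all_reals all_analysis.

Set Implicit Arguments.
Unset Strict Implicit.
Unset Printing Implicit Defensive.

Import Order.TTheory GRing.Theory Num.Theory.
Import numFieldNormedType.Exports.

Local Open Scope classical_set_scope.
Local Open Scope ring_scope.

(** Algorithms are the closed terms of the weak call-by-value lambda-calculus
    (Plotkin; Dal Lago and Martini; Forster and Smolka), in de Bruijn notation.
    It is Turing-complete, and programs are first-class: an algorithm may
    return programs. *)
Inductive term : Type :=
| Var of nat
| App of term & term
| Lam of term.

Fixpoint closed_below (n : nat) (s : term) : bool :=
  match s with
  | Var i => (i < n)%N
  | App s1 s2 => closed_below n s1 && closed_below n s2
  | Lam s1 => closed_below n.+1 s1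
  end.

Definition closed_term (s : term) : bool := closed_below 0 s.

(** [u] is not lifted under binders: during the evaluation of a closed term,
    only closed terms are ever substituted. *)
Fixpoint subst (s : term) (i : nat) (u : term) : term :=
  match s with
  | Var j => if j == i then u else Var j
  | App s1 s2 => App (subst s1 i u) (subst s2 i u)
  | Lam s1 => Lam (subst s1 i.+1 u)
  end.

(** [evals_to s t]: the evaluation of [s] terminates with value [t]. *)
Inductive evals_to : term -> term -> Prop :=
| evals_Lam s : evals_to (Lam s) (Lam s)
| evals_App s s1 t t1 u :
    evals_to s (Lam s1) -> evals_to t (Lam t1) -> evals_to (subst s1 0 (Lam t1)) u ->
    evals_to (App s t) u.

(** Scott encodings of data. *)
Definition enc_bool (b : bool) : term := Lam (Lam (Var (if b then 1 else 0))).

Fixpoint enc_nat (n : nat) : term :=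
  if n is m.+1 then Lam (Lam (App (Var 0) (enc_nat m))) else Lam (Lam (Var 1)).

Definition enc_int (z : int) : term :=
  match z with
  | Posz n => Lam (Lam (App (Var 1) (enc_nat n)))
  | Negz n => Lam (Lam (App (Var 0) (enc_nat n)))
  end.

Definition enc_pair (s t : term) : term := Lam (App (App (Var 0) s) t).

(** Rationals are presented as reduced fractions. *)
Definition enc_rat (q : rat) : term :=
  enc_pair (enc_int (numq q)) (enc_int (denq q)).

Fixpoint enc_list (l : seq term) : term :=
  if l is s :: l1 then Lam (Lam (App (App (Var 0) s) (enc_list l1)))
  else Lam (Lam (Var 1)).

Definition enc_ord (k : nat) (i : 'I_k) : term := enc_nat i.

Definition computes (X Y : Type) (encX : X -> term) (encY : Y -> term)
    (p : term) (f : X -> Y) : Prop :=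
  forall x, evals_to (App p (encX x)) (encY (f x)).

Definition computable (X Y : Type) (encX : X -> term) (encY : Y -> term)
    (f : X -> Y) : Prop :=
  exists2 p, closed_term p & computes encX encY p f.

Definition computable_real (R : realType) (x : R) : Prop :=
  exists2 q : nat -> rat, computable enc_nat enc_rat q &
    forall n, `|x - ratr (q n)| <= 2 ^- n.

(** A vertex of the infinite rooted [k]-ary tree is the sequence of children
    chosen on the way from the root [[::]]. *)
Definition vertex (k : nat) : Type := seq 'I_k.

Definition enc_vertex (k : nat) (v : vertex k) : term :=
  enc_list [seq enc_ord i | i <- v].

(** Total weight of the vertices of [A], measured in the subtree rooted at [v];
    meaningful when [A] is included in that subtree. *)
Definition weight (R : realType) (beta : R) (k : nat) (v : vertex k)
    (A : set (vertex k)) : \bar R :=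
  (\esum_(u in A) (beta ^- (size u - size v)%N)%:E)%E.

(** Alice's earlier moves are determined by her strategy and by Bob's moves, so
    a history is the sequence of Bob's moves, i.e. his current position.
    The strategy returns the set of the vertices newly forbidden. *)
Definition strategy (k : nat) : Type := vertex k -> set (vertex k).

(** The set of forbidden vertices when Bob, playing against [sigma], has just
    arrived at [v] and Alice has not moved there yet. *)
Definition forbidden (k : nat) (sigma : strategy k) (v : vertex k) :
    set (vertex k) :=
  \bigcup_(i in [set i | (i < size v)%N]) sigma (take i v).

(** Bob has not lost on his way from the root to [v], [v] included. *)
Definition alive (k : nat) (sigma : strategy k) (v : vertex k) : Prop :=
  forall i, (i <= size v)%N -> ~ forbidden sigma (take i v) (take i v).

(** [A] may become newly forbidden when Bob is at [v] and [F] is the set of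
    vertices that are already forbidden. *)
Definition legal_move (R : realType) (beta omega : R) (k : nat)
    (v : vertex k) (F A : set (vertex k)) : Prop :=
  [/\ A `<=` [set u | prefix v u /\ u <> v],
      A `&` F = set0 &
      (weight beta v A <= omega%:E)%E].

Definition legal_strategy (R : realType) (beta omega : R) (k : nat)
    (sigma : strategy k) : Prop :=
  forall v, alive sigma v ->
    legal_move beta omega v (forbidden sigma v) (sigma v).

Definition decides (k : nat) (p : term) (A : set (vertex k)) : Prop :=
  computes (@enc_vertex k) enc_bool p (fun u => `[< A u >]).

Definition modulus_of_convergence (R : realType) (beta : R) (k : nat)
    (v : vertex k) (m : term) (A : set (vertex k)) : Prop :=
  forall e : rat, 0 < e -> exists2 N : int,
    evals_to (App m (enc_rat e)) (enc_int N) &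
    (weight beta v (A `&` [set u | (N < (size u)%:Z - (size v)%:Z)%R])
       < (ratr e)%:E)%E.

Definition computable_strategy (R : realType) (beta : R) (k : nat)
    (sigma : strategy k) : Prop :=
  exists2 s, closed_term s & forall v, alive sigma v ->
    exists p m, [/\ evals_to (App s (enc_vertex v)) (enc_pair p m),
                    decides p (sigma v) &
                    modulus_of_convergence beta v m (sigma v)].

(** An infinite path from the root is given by the children chosen at each
    step; its [n]-th vertex is [mkseq path n]. *)
Definition computable_path (k : nat) (path : nat -> 'I_k) : Prop :=
  computable enc_nat (@enc_ord k) path.

Definition Bob_wins (k : nat) (sigma : strategy k) (path : nat -> 'I_k) : Prop :=
  forall n, ~ forbidden sigma (mkseq path n) (mkseq path n).

(* Main.v *)
Require Import Defs.
From mathcomp Require Import all_boot all_order all_algebra.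
From mathcomp Require Import all_classical all_reals all_analysis.
From mathcomp Require Import ring lra.

(** Bob keeps the weight of the forbidden vertices of his current subtree below
    [1]. Alice's move raises it to less than [1 + omega]; passing to the children
    multiplies the total by [beta], so that the average over the [k] children is
    less than [beta * (1 + omega) / k <= 1] and some child is again lighter than
    [1]. Such a child is not itself forbidden, since a vertex weighs [1] in its own
    subtree. Being lighter than [1] is semi-decidable: the moduli of convergence
    bound the weight below a finite depth, and the rest is a finite sum, computed
    from above with a rational lower bound of [beta]. Hence Bob can search for a
    light child.

    Alice's answer [enc_pair p m] is only known to be closed as a whole: [p] and
    [m] may be open terms, whose naive evaluation captures variables and is not
    preserved when the pair is applied to a selector. Bob therefore runs an
    interpreter on the syntax of Alice's programs instead of applying them. *)

Set Implicit Arguments.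
Unset Strict Implicit.
Unset Printing Implicit Defensive.

(** * Evaluation of encoded data *)

(** Closedness is part of being a value: substitution then leaves values fixed, although [subst]
    does not lift under binders. *)
Definition is_value (t : term) : bool :=
  if t is Lam _ then closed_term t else false.

Lemma closed_below_le m n s : m <= n -> closed_below m s -> closed_below n s.
Proof.
elim: s m n => [i|s1 IH1 s2 IH2|s IH] m n /= mn.
- by move=> /leq_trans; apply.
- by case/andP=> /(IH1 _ _ mn) -> /(IH2 _ _ mn) ->.
- by apply: IH.
Qed.

Lemma subst_closed n s i u : closed_below n s -> n <= i -> subst s i u = s.
Proof.
elim: s n i => [j|s1 IH1 s2 IH2|s IH] n i /=.
- by move=> jn ni; case: eqP => // ji; move: (leq_trans jn ni); rewrite ji ltnn.
- by case/andP=> h1 h2 ni; rewrite (IH1 n) // (IH2 n).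
- by move=> h ni; rewrite (IH n.+1).
Qed.

Lemma value_closed t : is_value t -> closed_term t.
Proof. by case: t. Qed.

Lemma value_closed_below n t : is_value t -> closed_below n t.
Proof. by move=> /value_closed; apply: closed_below_le. Qed.

Lemma value_subst t i u : is_value t -> subst t i u = t.
Proof. by move=> /value_closed ct; apply: (@subst_closed 0). Qed.

Lemma evals_value t : is_value t -> evals_to t t.
Proof. by case: t => // s _; apply: evals_Lam. Qed.

Lemma evals_to_Lam s t : evals_to s t -> exists b, t = Lam b.
Proof. by elim=> // b; exists b. Qed.

Lemma evals_to_det s t t' : evals_to s t -> evals_to s t' -> t = t'.
Proof.
move=> h; elim: h t' => [b|a a1 b b1 u _ IHa _ IHb _ IHu] t' h'.
  by inversion h'.
inversion h' as [|x a2 y b2 w ha hb hu]; subst.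
by case: (IHa _ ha) => ?; case: (IHb _ hb) => ?; subst; apply: IHu.
Qed.

Lemma evals_to_App a b va vb u : evals_to a va -> evals_to b vb ->
  evals_to (App va vb) u -> evals_to (App a b) u.
Proof.
move=> ha hb; have [a1 ea] := evals_to_Lam ha; have [b1 eb] := evals_to_Lam hb.
subst => h; inversion h as [|x a2 y b2 w h1 h2 hu]; subst.
by inversion h1; inversion h2; subst; apply: evals_App hu.
Qed.

Lemma evals_to_head a va b u : evals_to a va -> evals_to (App va b) u ->
  evals_to (App a b) u.
Proof.
move=> ha h; inversion h as [|x a2 y b2 w h1 h2 hu]; subst.
have [a1 ea] := evals_to_Lam ha; subst; inversion h1; subst.
exact: evals_App ha h2 hu.
Qed.

Lemma evals_to_arg a b vb u : evals_to b vb -> evals_to (App a vb) u ->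
  evals_to (App a b) u.
Proof.
move=> hb h; inversion h as [|x a2 y b2 w h1 h2 hu]; subst.
have [b1 eb] := evals_to_Lam hb; subst; inversion h2; subst.
exact: evals_App h1 hb hu.
Qed.

Lemma evals_to_head_arg a b vb c u : evals_to b vb ->
  evals_to (App (App a vb) c) u -> evals_to (App (App a b) c) u.
Proof.
move=> hb h; inversion h as [|x a2 y b2 w h1 h2 hu]; subst.
exact: evals_App (evals_to_arg hb h1) h2 hu.
Qed.

Lemma evals_to_head_head a va b c u : evals_to a va ->
  evals_to (App (App va b) c) u -> evals_to (App (App a b) c) u.
Proof.
move=> ha h; inversion h as [|x a2 y b2 w h1 h2 hu]; subst.
exact: evals_App (evals_to_head ha h1) h2 hu.
Qed.

Lemma evals_to_beta s v u : is_value v ->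
  evals_to (subst s 0 v) u -> evals_to (App (Lam s) v) u.
Proof.
by case: v => // v _ h; apply: evals_App h; apply: evals_Lam.
Qed.

(** * Data types encoded by closed values *)

Structure codeType := CodeType {
  code_sort :> Type;
  code : code_sort -> term;
  codeP : forall x, is_value (code x) }.
Arguments code {_} x : simpl never.

Ltac vals :=
  first [ exact: codeP | assumption
        | rewrite /is_value /closed_term /= ?value_closed_below ?codeP //; fail ].
Ltac subs :=
  simpl subst;
  repeat match goal with
  | |- context [subst ?t ?i ?u] => rewrite (@value_subst t i u); [|vals]
  end.

Lemma enc_bool_value b : is_value (enc_bool b).
Proof. by case: b. Qed.
Canonical bool_code := CodeType enc_bool_value.

Lemma enc_nat_value n : is_value (enc_nat n).
Proof. by elim: n => //= n IH; vals. Qed.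
Canonical nat_code := CodeType enc_nat_value.

Lemma enc_int_value z : is_value (enc_int z).
Proof. by case: z => n; have h := enc_nat_value n; rewrite /enc_int; vals. Qed.
Canonical int_code := CodeType enc_int_value.

Lemma enc_prod_value (X Y : codeType) (x : X * Y) :
  is_value (enc_pair (code x.1) (code x.2)).
Proof. by rewrite /enc_pair; vals. Qed.
Canonical prod_code X Y := CodeType (@enc_prod_value X Y).

Lemma enc_seq_value (X : codeType) (l : seq X) :
  is_value (enc_list [seq code x | x <- l]).
Proof. by elim: l => //= x l IH; vals. Qed.
Canonical seq_code X := CodeType (@enc_seq_value X).

(** Scott encoding of syntax with one selector per constructor. It turns programs into data on which
    the interpreter can branch and recurse. *)
Fixpoint enc_term (t : term) : term :=
  match t with
  | Var n => Lam (Lam (Lam (App (Var 2) (enc_nat n))))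
  | App a b => Lam (Lam (Lam (App (App (Var 1) (enc_term a)) (enc_term b))))
  | Lam a => Lam (Lam (Lam (App (Var 0) (enc_term a))))
  end.

Lemma enc_term_value t : is_value (enc_term t).
Proof.
elim: t => /= [n|a IHa b IHb|a IHa]; [|vals|vals].
by have h := enc_nat_value n; vals.
Qed.
Canonical term_code := CodeType enc_term_value.

Lemma code_nat0 : code 0 = Lam (Lam (Var 1)). Proof. by []. Qed.
Lemma code_natS n : code n.+1 = Lam (Lam (App (Var 0) (code n))).
Proof. by []. Qed.
Lemma code_Posz n : code (Posz n) = Lam (Lam (App (Var 1) (code n))).
Proof. by []. Qed.
Lemma code_Negz n : code (Negz n) = Lam (Lam (App (Var 0) (code n))).
Proof. by []. Qed.
Lemma code_pair (X Y : codeType) (x : X * Y) :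
  code x = Lam (App (App (Var 0) (code x.1)) (code x.2)).
Proof. by []. Qed.
Lemma code_nil (X : codeType) : code ([::] : seq X) = Lam (Lam (Var 1)).
Proof. by []. Qed.
Lemma code_cons (X : codeType) (x : X) l :
  code (x :: l) = Lam (Lam (App (App (Var 0) (code x)) (code l))).
Proof. by []. Qed.
Lemma code_Var n : code (Var n) = Lam (Lam (Lam (App (Var 2) (code n)))).
Proof. by []. Qed.
Lemma code_App a b :
  code (App a b) = Lam (Lam (Lam (App (App (Var 1) (code a)) (code b)))).
Proof. by []. Qed.
Lemma code_Lam a : code (Lam a) = Lam (Lam (Lam (App (Var 0) (code a)))).
Proof. by []. Qed.

Definition tpair : term := Lam (Lam (Lam (App (App (Var 0) (Var 2)) (Var 1)))).

Lemma tpairP (X Y : codeType) (x : X) (y : Y) a b :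
  evals_to a (code x) -> evals_to b (code y) ->
  evals_to (App (App tpair a) b) (code (x, y)).
Proof.
move=> ha hb; apply: evals_to_App hb _.
  apply: evals_to_App ha _; first exact: evals_Lam.
  by apply: evals_to_beta; [vals|subs; apply: evals_Lam].
by apply: evals_to_beta; [vals|subs; apply: evals_Lam].
Qed.

Definition tsucc : term := Lam (Lam (Lam (App (Var 0) (Var 2)))).

Lemma tsuccP n a : evals_to a (code n) -> evals_to (App tsucc a) (code n.+1).
Proof.
move=> ha; apply: evals_to_App ha _; first exact: evals_Lam.
by apply: evals_to_beta; [vals|subs; apply: evals_Lam].
Qed.

Lemma tpair_value : is_value tpair. Proof. by []. Qed.
Lemma tsucc_value : is_value tsucc. Proof. by []. Qed.
#[local] Hint Resolve tpair_value tsucc_value codeP : core.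
Opaque tpair tsucc.

Ltac is_val t :=
  lazymatch t with
  | Lam _ => idtac | code _ => idtac | tpair => idtac | tsucc => idtac
  | _ => is_var t end.

(** Symbolic call-by-value evaluation. An abstraction applied to a value is reduced by substitution;
    a program known only by its specification is handled through a matching hypothesis of the
    context. *)
Ltac ev :=
  lazymatch goal with
  | |- evals_to (Lam _) _ => apply: evals_Lam
  | |- evals_to (App (App tpair _) _) _ => eapply tpairP; [ev|ev]
  | |- evals_to (App tsucc _) _ => eapply tsuccP; ev
  | |- evals_to (App ?a ?b) _ =>
    tryif (is_val a; is_val b) then
      lazymatch a with
      | Lam _ => apply: evals_to_beta; [vals | subs; ev]
      | _ => try match goal with
        | H : forall _, evals_to (App a _) _ |- _ => eapply H; eauto
        | H : forall _, _ -> evals_to (App a _) _ |- _ => eapply H; eauto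
        end
      end
    else (eapply evals_to_App; [ev | ev | ev])
  | |- evals_to _ _ => apply: evals_value; vals
  end.

(** Half of Turing's fixed-point combinator. The recursive call is eta-expanded, since call-by-value
    evaluation would otherwise unfold it forever. *)
Definition tfix_aux : term :=
  Lam (Lam (App (Var 0) (Lam (App (App (App (Var 2) (Var 2)) (Var 1)) (Var 0))))).

Lemma fixpointP B : is_value B -> exists2 F, is_value F &
  forall v t, is_value v -> evals_to (App (App B F) v) t -> evals_to (App F v) t.
Proof.
move=> vB; exists (Lam (App (App (App tfix_aux tfix_aux) B) (Var 0))).
  by vals.
move=> v t vv h; apply: evals_to_beta => //; subs.
have vr : is_value tfix_aux by [].
inversion h as [|x a2 y b2 w h1 h2 hu]; subst.
have hv : evals_to v v by apply: evals_value.
apply: evals_App hu => //.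
apply: evals_to_App; [ | exact: evals_value | ].
  by apply: evals_to_beta; [vals|subs; apply: evals_Lam].
by apply: evals_to_beta; [vals|subs].
Qed.


(** * Closure properties of computable functions *)

(** Outside [D] nothing is asked of the program, not even termination. This accommodates Alice's
    programs, which are specified only at alive vertices, as well as unbounded search. *)
Definition computable_on (X Y : codeType) (D : X -> Prop) (f : X -> Y) : Prop :=
  exists2 p, is_value p & forall x, D x -> evals_to (App p (code x)) (code (f x)).

Lemma computable_on_weaken (X Y : codeType) (D D' : X -> Prop) (f g : X -> Y) :
  (forall x, D' x -> D x) -> (forall x, D' x -> f x = g x) ->
  computable_on D f -> computable_on D' g.
Proof.
by move=> DD fg [p vp h]; exists p => // x Dx; rewrite -fg //; apply: h (DD _ Dx).
Qed.

Lemma computable_on_comp (X Y Z : codeType) (D : X -> Prop) (E : Y -> Prop)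
    (f : X -> Y) (g : Y -> Z) :
  computable_on E g -> computable_on D f -> (forall x, D x -> E (f x)) ->
  computable_on D (fun x => g (f x)).
Proof.
move=> [q vq hq] [p vp hp] DE; exists (Lam (App q (App p (Var 0)))); first by vals.
by move=> x Dx; ev.
Qed.

Lemma computable_on_id (X : codeType) D : computable_on D (fun x : X => x).
Proof. by exists (Lam (Var 0)) => // x Dx; ev. Qed.

Lemma computable_on_const (X Y : codeType) (D : X -> Prop) (y : Y) :
  computable_on D (fun=> y).
Proof. by exists (Lam (code y)); [vals | move=> x Dx; ev]. Qed.

Lemma computable_on_pair (X Y Z : codeType) (D : X -> Prop) (f : X -> Y) (g : X -> Z) :
  computable_on D f -> computable_on D g -> computable_on D (fun x => (f x, g x)).
Proof.
move=> [p vp hp] [q vq hq].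
exists (Lam (App (App tpair (App p (Var 0))) (App q (Var 0)))); first by vals.
by move=> x Dx; ev.
Qed.

Lemma computable_on_fst (X Y Z : codeType) (D : X -> Prop) (f : X -> Y * Z) :
  computable_on D f -> computable_on D (fun x => (f x).1).
Proof.
move=> [p vp hp].
exists (Lam (App (App p (Var 0)) (Lam (Lam (Var 1))))); first by vals.
move=> x Dx; apply: evals_to_beta; [vals|subs].
eapply evals_to_App; [exact: hp|ev|].
rewrite code_pair; ev.
Qed.

Lemma computable_on_snd (X Y Z : codeType) (D : X -> Prop) (f : X -> Y * Z) :
  computable_on D f -> computable_on D (fun x => (f x).2).
Proof.
move=> [p vp hp].
exists (Lam (App (App p (Var 0)) (Lam (Lam (Var 0))))); first by vals.
move=> x Dx; apply: evals_to_beta; [vals|subs].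
eapply evals_to_App; [exact: hp|ev|].
rewrite code_pair; ev.
Qed.

Lemma computable_on_if (X Y : codeType) (D : X -> Prop) (b : X -> bool) (f g : X -> Y) :
  computable_on D b -> computable_on (fun x => D x /\ b x) f ->
  computable_on (fun x => D x /\ ~~ b x) g ->
  computable_on D (fun x => if b x then f x else g x).
Proof.
move=> [r vr hr] [p vp hp] [q vq hq].
(* The boolean selects between the programs [p] and [q], and only the selected one is run on the
   input; the other may diverge there. *)
exists (Lam (App (App (App (App r (Var 0)) p) q) (Var 0))); first by vals.
move=> x Dx; apply: evals_to_beta; [vals|subs].
eapply evals_to_App; [|ev|]; last first.
  have : evals_to (App (if b x then p else q) (code x))
                  (code (if b x then f x else g x)).
    by case: ifPn => bx; [apply: hp | apply: hq].
  by move=> h; exact: h.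
eapply evals_to_App; [|ev|]; first (eapply evals_to_App; [exact: hr|ev|]).
  by rewrite /code /= /enc_bool; ev.
by case: (b x); subs; ev.
Qed.

Lemma computable_on_succ (X : codeType) (D : X -> Prop) (f : X -> nat) :
  computable_on D f -> computable_on D (fun x => (f x).+1).
Proof.
move=> [p vp hp]; exists (Lam (App tsucc (App p (Var 0)))); first by vals.
by move=> x Dx; ev.
Qed.

Lemma computable_on_absz (X : codeType) (D : X -> Prop) (f : X -> int) :
  computable_on D f -> computable_on D (fun x => absz (f x)).
Proof.
move=> [p vp hp].
(* [Negz n] stands for [-(n + 1)], hence the successor in the second branch. *)
exists (Lam (App (App (App p (Var 0)) (Lam (Var 0))) tsucc)); first by vals.
move=> x Dx; apply: evals_to_beta; [vals|subs].
apply: evals_to_head_head (hp _ Dx) _.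
by case: (f x) => n; rewrite ?code_Posz ?code_Negz /=; ev.
Qed.

Lemma computable_on_cons (X Y : codeType) (D : X -> Prop) (f : X -> Y) g :
  computable_on D f -> computable_on D g -> computable_on D (fun x => f x :: g x).
Proof.
move=> [p vp hp] [q vq hq].
exists (Lam (App (App (Lam (Lam (Lam (Lam (App (App (Var 0) (Var 3)) (Var 2))))))
   (App p (Var 0))) (App q (Var 0)))); first by vals.
by move=> x Dx; ev.
Qed.

Lemma computable_on_Var (X : codeType) (D : X -> Prop) (f : X -> nat) :
  computable_on D f -> computable_on D (fun x => Var (f x)).
Proof.
move=> [p vp hp].
exists (Lam (App (Lam (Lam (Lam (Lam (App (Var 2) (Var 3)))))) (App p (Var 0)))).
  by vals.
by move=> x Dx; ev.
Qed.

Lemma computable_on_App (X : codeType) (D : X -> Prop) (f g : X -> term) :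
  computable_on D f -> computable_on D g -> computable_on D (fun x => App (f x) (g x)).
Proof.
move=> [p vp hp] [q vq hq].
exists (Lam (App (App
  (Lam (Lam (Lam (Lam (Lam (App (App (Var 1) (Var 4)) (Var 3)))))))
  (App p (Var 0))) (App q (Var 0)))); first by vals.
by move=> x Dx; ev.
Qed.

Lemma computable_on_Lam (X : codeType) (D : X -> Prop) (f : X -> term) :
  computable_on D f -> computable_on D (fun x => Lam (f x)).
Proof.
move=> [p vp hp].
exists (Lam (App (Lam (Lam (Lam (Lam (App (Var 0) (Var 3)))))) (App p (Var 0)))).
  by vals.
by move=> x Dx; ev.
Qed.

(** The step [h] has to be computable only on triples that occur in the recursion, whose last entry
    is the true intermediate value. Invariants of [f] can thus be used to justify that [h]
    terminates. *)
Lemma computable_on_nat_rec (X Y : codeType) (D : X -> Prop) (n : X -> nat)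
    (f : X -> nat -> Y) (h : X * (nat * Y) -> Y) :
  (forall x m, D x -> (m < n x)%N -> f x m.+1 = h (x, (m, f x m))) ->
  computable_on D n -> computable_on D (fun x => f x 0) ->
  computable_on
    (fun y => [/\ D y.1, (y.2.1 < n y.1)%N & y.2.2 = f y.1 y.2.1]) h ->
  computable_on D (fun x => f x (n x)).
Proof.
move=> fS [pn vn hn] [p0 v0 h0] [ph vh hh].
(* The number is the first argument and the parameter the last: both cases are abstractions awaiting
   the parameter, so no recursive call starts before a case is selected. *)
have /fixpointP[F vF hF] : is_value (Lam (Lam (App (App (Var 0) p0)
  (Lam (Lam (App ph (App (App tpair (Var 0)) (App (App tpair (Var 1))
    (App (App (Var 3) (Var 1)) (Var 0)))))))))) by vals.
have FP x m : D x -> (m <= n x)%N ->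
    evals_to (App (App F (code m)) (code x)) (code (f x m)).
  move=> Dx; elim: m => [|m IH] mn.
    eapply evals_to_App; [|ev|]; last exact: h0.
    by apply: hF; [vals|]; rewrite code_nat0; ev.
  have {}IH := IH (ltnW mn).
  eapply evals_to_App; [|ev|].
    by apply: hF; [vals|]; rewrite code_natS; ev.
  apply: evals_to_beta; [vals|subs].
  eapply evals_to_App; [ev| |rewrite fS //; apply: hh].
    by eapply tpairP; [ev|]; eapply tpairP; [ev|exact: IH].
  by [].
exists (Lam (App (App F (App pn (Var 0))) (Var 0))); first by vals.
move=> x Dx; apply: evals_to_beta; [vals|subs].
have := FP x (n x) Dx (leqnn _) => h1.
exact: evals_to_head_arg (hn _ Dx) h1.
Qed.

Lemma computable_on_list_rec (X A Y : codeType) (D : X -> Prop) (l : X -> seq A)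
    (f : X -> seq A -> Y) (h : X * (A * Y) -> Y) :
  (forall x a l1 l2, D x -> l x = l1 ++ a :: l2 ->
     f x (a :: l2) = h (x, (a, f x l2))) ->
  computable_on D l -> computable_on D (fun x => f x [::]) ->
  computable_on (fun y => D y.1 /\
    exists l1 l2, l y.1 = l1 ++ y.2.1 :: l2 /\ y.2.2 = f y.1 l2) h ->
  computable_on D (fun x => f x (l x)).
Proof.
move=> fS [pl vl hl] [p0 v0 h0] [ph vh hh].
have /fixpointP[F vF hF] : is_value (Lam (Lam (App (App (Var 0) p0)
  (Lam (Lam (Lam (App ph (App (App tpair (Var 0)) (App (App tpair (Var 2))
    (App (App (Var 4) (Var 1)) (Var 0))))))))))) by vals.
have FP x l1 l2 : D x -> l x = l1 ++ l2 ->
    evals_to (App (App F (code l2)) (code x)) (code (f x l2)).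
  move=> Dx; elim: l2 l1 => [|a l2 IH] l1 lE.
    eapply evals_to_App; [|ev|]; last exact: h0.
    by apply: hF; [vals|]; rewrite code_nil; ev.
  have {}IH := IH (rcons l1 a); rewrite cat_rcons in IH; have {}IH := IH lE.
  eapply evals_to_App; [|ev|].
    by apply: hF; [vals|]; rewrite code_cons; ev.
  apply: evals_to_beta; [vals|subs].
  eapply evals_to_App; [ev| |rewrite (fS _ _ _ _ Dx lE); apply: hh].
    by eapply tpairP; [ev|]; eapply tpairP; [ev|exact: IH].
  by split=> //=; exists l1, l2.
exists (Lam (App (App F (App pl (Var 0))) (Var 0))); first by vals.
move=> x Dx; apply: evals_to_beta; [vals|subs].
have := FP x [::] (l x) Dx erefl => h1.
exact: evals_to_head_arg (hl _ Dx) h1.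
Qed.

(** Unbounded minimization, by a loop that tests [0], [1], and so on; on [D] a successful test is
    guaranteed. *)
Lemma computable_on_search (X : codeType) (D : X -> Prop) (b : X -> nat -> bool)
    (g : X -> nat) :
  (forall x, D x -> b x (g x) /\ forall m, (m < g x)%N -> ~~ b x m) ->
  computable_on (fun y => D y.1) (fun y => b y.1 y.2) -> computable_on D g.
Proof.
move=> gP [p vp hp].
(* Both outcomes of the test are delayed under a binder, so that the loop continues only after a
   failed test. *)
have /fixpointP[F vF hF] : is_value (Lam (Lam (Lam
  (App (App (App (App p (App (App tpair (Var 0)) (Var 1)))
    (Lam (Var 2)))
    (Lam (App (App (Var 3) (App tsucc (Var 2))) (Var 0)))) (Var 0))))) by vals.
(* The loop counts upwards, so the induction is on the distance [d] that remains to the answer. *)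
have FP x d : D x -> (d <= g x)%N ->
    evals_to (App (App F (code (g x - d)%N)) (code x)) (code (g x)).
  move=> Dx; have [bg ng] := gP x Dx; elim: d => [|d IH] dg.
    rewrite subn0; eapply evals_to_App; [|ev|].
      by apply: hF; [vals|]; ev.
    apply: evals_to_beta; [vals|subs].
    eapply evals_to_App; [|ev|].
      eapply evals_to_App; [eapply evals_to_App; [|ev|]|ev|].
      - eapply evals_to_App; [ev|ev|]; exact: (hp (x, g x) Dx).
      - by rewrite /= bg /code /= /enc_bool -/(code (g x)) -/(code x); ev.
      - by ev.
    by ev.
  have {}IH := IH (ltnW dg); have := ng (g x - d.+1)%N; rewrite ltn_subrL /=.
  rewrite (leq_trans _ dg) // => /(_ erefl) /negbTE nb.
  set m := (g x - d.+1)%N in nb *.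
  have mE : (g x - d)%N = m.+1 by rewrite /m subnSK.
  rewrite mE in IH.
  eapply evals_to_App; [|ev|].
    by apply: hF; [vals|]; ev.
  apply: evals_to_beta; [vals|subs].
  eapply evals_to_App; [|ev|].
    eapply evals_to_App; [eapply evals_to_App; [|ev|]|ev|].
    - eapply evals_to_App; [ev|ev|]; exact: (hp (x, m) Dx).
    - by rewrite /= nb /code /= /enc_bool -/(code m) -/(code x); ev.
    - by ev.
  apply: evals_to_beta; [vals|subs].
  by apply: evals_to_head_arg IH; ev.
exists (Lam (App (App F (code 0)) (Var 0))); first by vals.
move=> x Dx; apply: evals_to_beta; [vals|subs].
by have := FP x (g x) Dx (leqnn _); rewrite subnn.
Qed.

(** The parameter is updated by [g] under a binder, as required by substitution, whose index
    increases there. *)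
Lemma computable_on_term_rec (X Y : codeType) (f : X -> term -> Y) (g : X -> X)
    (fv : X * nat -> Y) (fa : X * ((term * term) * (Y * Y)) -> Y)
    (fl : X * (term * Y) -> Y) :
  (forall x n, f x (Var n) = fv (x, n)) ->
  (forall x a b, f x (App a b) = fa (x, ((a, b), (f x a, f x b)))) ->
  (forall x a, f x (Lam a) = fl (x, (a, f (g x) a))) ->
  computable_on xpredT g -> computable_on xpredT fv -> computable_on xpredT fa ->
  computable_on xpredT fl ->
  computable_on xpredT (fun y => f y.1 y.2).
Proof.
move=> fvE faE flE [pg vg hg] [pv vv hv] [pa va ha] [pl vl hl].
have {}hg x := hg x isT; have {}hv x := hv x isT.
have {}ha x := ha x isT; have {}hl x := hl x isT.
have /fixpointP[F vF hF] : is_value (Lam (Lam (App (App (App (Var 0)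
    (Lam (Lam (App pv (App (App tpair (Var 0)) (Var 1))))))
    (Lam (Lam (Lam (App pa (App (App tpair (Var 0))
      (App (App tpair (App (App tpair (Var 2)) (Var 1)))
        (App (App tpair (App (App (Var 4) (Var 2)) (Var 0)))
          (App (App (Var 4) (Var 1)) (Var 0)))))))))) 
    (Lam (Lam (App pl (App (App tpair (Var 0)) (App (App tpair (Var 1))
      (App (App (Var 3) (Var 1)) (App pg (Var 0))))))))))) by vals.
have FP t x : evals_to (App (App F (code t)) (code x)) (code (f x t)).
  elim: t x => [n|a IHa b IHb|a IHa] x.
  - eapply evals_to_App; [apply: hF; [vals|rewrite code_Var; ev]|ev|].
    by apply: evals_to_beta; [vals|subs]; rewrite fvE; ev.
  - eapply evals_to_App; [apply: hF; [vals|rewrite code_App; ev]|ev|].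
    apply: evals_to_beta; [vals|subs]; rewrite faE.
    eapply evals_to_App; [ev| |exact: ha].
    eapply tpairP; [ev|]; eapply tpairP; [ev|].
    by apply: tpairP; [exact: IHa|exact: IHb].
  - eapply evals_to_App; [apply: hF; [vals|rewrite code_Lam; ev]|ev|].
    apply: evals_to_beta; [vals|subs]; rewrite flE.
    eapply evals_to_App; [ev| |exact: hl].
    eapply tpairP; [ev|]; eapply tpairP; [ev|].
    by apply: evals_to_arg (hg _) _; exact: IHa.
exists (Lam (App (App F (App (Var 0) (Lam (Lam (Var 0)))))
                 (App (Var 0) (Lam (Lam (Var 1)))))); first by vals.
case=> x t _; apply: evals_to_beta; [vals|subs].
apply: evals_to_head_arg; last first.
  apply: evals_to_arg; last exact: FP.
  by rewrite code_pair /=; ev.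
by rewrite code_pair /=; ev.
Qed.

Ltac compute_on_step :=
  lazymatch goal with
  | |- computable_on _ (fun x => x) => exact: computable_on_id
  | |- computable_on _ (fun _ => ?c) => exact: computable_on_const
  | |- computable_on _ (fun x => (@?f x, @?g x)) =>
    apply: (computable_on_pair (f := f) (g := g))
  | |- computable_on _ (fun x => (@?f x).1) => apply: (computable_on_fst (f := f))
  | |- computable_on _ (fun x => (@?f x).2) => apply: (computable_on_snd (f := f))
  | |- computable_on _ (@fst _ _) => exact: (computable_on_fst (computable_on_id _))
  | |- computable_on _ (@snd _ _) => exact: (computable_on_snd (computable_on_id _))
  | |- computable_on _ (fun x => (@?f x).+1) => apply: (computable_on_succ (f := f))
  | |- computable_on _ (fun x => absz (@?f x)) => apply: (computable_on_absz (f := f))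
  | |- computable_on _ (fun x => @?f x :: @?g x) =>
    apply: (computable_on_cons (f := f) (g := g))
  | |- computable_on _ (fun x => Var (@?f x)) => apply: (computable_on_Var (f := f))
  | |- computable_on _ (fun x => App (@?f x) (@?g x)) =>
    apply: (computable_on_App (f := f) (g := g))
  | |- computable_on _ (fun x => Lam (@?f x)) => apply: (computable_on_Lam (f := f))
  end.
Ltac compute_on := repeat compute_on_step.

(** * Computable arithmetic and list operations *)

Lemma computable_on1 (X Y Z : codeType) (D : X -> Prop) (g : Y -> Z) f :
  computable_on xpredT g -> computable_on D f -> computable_on D (fun x => g (f x)).
Proof. by move=> hg hf; apply: computable_on_comp hg hf _. Qed.

Lemma computable_on2 (X Y1 Y2 Z : codeType) (D : X -> Prop) (g : Y1 -> Y2 -> Z) f1 f2 :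
  computable_on xpredT (fun y => g y.1 y.2) ->
  computable_on D f1 -> computable_on D f2 ->
  computable_on D (fun x => g (f1 x) (f2 x)).
Proof.
move=> hg h1 h2.
by apply: (computable_on_comp (f := fun x => (f1 x, f2 x)) hg) => //; compute_on.
Qed.

Lemma computable_on_pred (X : codeType) (D : X -> Prop) f :
  computable_on D f -> computable_on D (fun x => (f x).-1).
Proof.
apply: computable_on1.
apply: (@computable_on_nat_rec _ _ _ (fun n => n) (fun _ n => n.-1)
  (fun y => y.2.1)) => //; compute_on.
Qed.

Lemma computable_on_addn (X : codeType) (D : X -> Prop) f g :
  computable_on D f -> computable_on D g -> computable_on D (fun x => f x + g x).
Proof.
apply: computable_on2.
apply: (@computable_on_nat_rec _ _ _ (fun y => y.2) (fun y n => y.1 + n)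
  (fun y => y.2.2.+1)); [|compute_on..].
  by move=> x m _ _; rewrite addnS.
by apply: computable_on_weaken (computable_on_fst (computable_on_id xpredT)) => // x; rewrite addn0.
Qed.

Lemma computable_on_muln (X : codeType) (D : X -> Prop) f g :
  computable_on D f -> computable_on D g -> computable_on D (fun x => f x * g x).
Proof.
apply: computable_on2.
apply: (@computable_on_nat_rec _ _ _ (fun y => y.2) (fun y n => y.1 * n)
  (fun y => y.1.1 + y.2.2)); [|compute_on| |].
- by move=> x m _ _; rewrite mulnS.
- by apply: computable_on_weaken (computable_on_const xpredT 0) => // x; rewrite muln0.
- by apply: computable_on_addn; compute_on.
Qed.

Lemma computable_on_expn (X : codeType) (D : X -> Prop) f g :
  computable_on D f -> computable_on D g -> computable_on D (fun x => f x ^ g x).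
Proof.
apply: computable_on2.
apply: (@computable_on_nat_rec _ _ _ (fun y => y.2) (fun y n => y.1 ^ n)
  (fun y => y.1.1 * y.2.2)); [|compute_on| |].
- by move=> x m _ _; rewrite expnS.
- exact: (computable_on_const xpredT 1).
- by apply: computable_on_muln; compute_on.
Qed.

Lemma computable_on_subn (X : codeType) (D : X -> Prop) f g :
  computable_on D f -> computable_on D g -> computable_on D (fun x => f x - g x).
Proof.
apply: computable_on2.
apply: (@computable_on_nat_rec _ _ _ (fun y => y.2) (fun y n => y.1 - n)
  (fun y => y.2.2.-1)); [|compute_on| |].
- by move=> x m _ _; rewrite subnS.
- by apply: computable_on_weaken (computable_on_fst (computable_on_id xpredT)) => // x; rewrite subn0.
- by apply: computable_on_pred; compute_on.
Qed.

Lemma computable_on_leq (X : codeType) (D : X -> Prop) f g :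
  computable_on D f -> computable_on D g -> computable_on D (fun x => f x <= g x).
Proof.
move=> hf hg.
suff h : computable_on xpredT (fun n : nat => n == 0).
  exact: (computable_on1 h (computable_on_subn hf hg)).
by apply: (@computable_on_nat_rec _ _ _ (fun n => n) (fun _ n => n == 0)
  (fun y => false)) => //; compute_on.
Qed.

Lemma computable_on_eqn (X : codeType) (D : X -> Prop) (f g : X -> nat) :
  computable_on D f -> computable_on D g -> computable_on D (fun x => f x == g x).
Proof.
move=> hf hg.
have h : computable_on D (fun x => if f x <= g x then g x <= f x else false).
  apply: computable_on_if; [exact: computable_on_leq| |compute_on].
  by apply: computable_on_weaken (computable_on_leq hg hf) => // x [].
by apply: computable_on_weaken h => // x _; rewrite eqn_leq; case: (f x <= g x).
Qed.

Lemma computable_on_modn (X : codeType) (D : X -> Prop) k f : 0 < k ->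
  computable_on D f -> computable_on D (fun x => f x %% k).
Proof.
move=> k0; apply: (@computable_on1 _ _ _ _ (modn^~ k)).
apply: (@computable_on_nat_rec _ _ _ (fun n => n) (fun _ n => n %% k)
  (* The remainder is obtained by counting cyclically, with a reset at [k]. *)
  (fun y => if y.2.2.+1 == k then 0 else y.2.2.+1)); [|compute_on| |].
- move=> _ m _ _ /=; rewrite modnS /dvdn -addn1 -modnDml addn1.
  have := ltn_pmod m k0; rewrite leq_eqVlt => /orP[/eqP ->|h].
    by rewrite modnn !eqxx.
  by rewrite modn_small // (ltn_eqF h).
- by apply: computable_on_weaken (computable_on_const xpredT 0) => // x; rewrite mod0n.
- by apply: computable_on_if; [apply: computable_on_eqn|..]; compute_on.
Qed.

Lemma computable_on_size (X Y : codeType) (D : X -> Prop) (f : X -> seq Y) :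
  computable_on D f -> computable_on D (fun x => size (f x)).
Proof.
apply: computable_on1.
by apply: (@computable_on_list_rec (seq_code Y) Y nat_code xpredT
  (fun l => l) (fun _ l => size l)
  (fun y => y.2.2.+1)) => //; compute_on.
Qed.

Lemma computable_on_cat (X Y : codeType) (D : X -> Prop) (f g : X -> seq Y) :
  computable_on D f -> computable_on D g -> computable_on D (fun x => f x ++ g x).
Proof.
apply: computable_on2.
by apply: (@computable_on_list_rec (prod_code (seq_code Y) (seq_code Y)) Y
  (seq_code Y) xpredT (fun y => y.1) (fun y l => l ++ y.2)
  (fun y => y.2.1 :: y.2.2)) => //=; compute_on.
Qed.

Lemma computable_on_rcons (X Y : codeType) (D : X -> Prop) (f : X -> seq Y) g :
  computable_on D f -> computable_on D g -> computable_on D (fun x => rcons (f x) (g x)).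
Proof.
move=> hf hg.
have h : computable_on D (fun x => f x ++ [:: g x]).
  by apply: computable_on_cat => //; compute_on.
by apply: computable_on_weaken h => // x _; rewrite cats1.
Qed.

Lemma computable_on_map (X A Y : codeType) (D : X -> Prop) (l : X -> seq A)
    (h : X -> A -> Y) :
  computable_on D l -> computable_on (fun y => D y.1) (fun y => h y.1 y.2) ->
  computable_on D (fun x => map (h x) (l x)).
Proof.
move=> hl hh.
apply: (@computable_on_list_rec _ _ _ _ l (fun x => map (h x))
  (fun y => h y.1 y.2.1 :: y.2.2)); [by []|exact: hl|exact: computable_on_const|].
apply: computable_on_cons; last by compute_on.
apply: (computable_on_comp (f := fun y => (y.1, y.2.1)) hh); first by compute_on.
by move=> x [].
Qed.

Lemma computable_on_has (X A : codeType) (D : X -> Prop) (l : X -> seq A)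
    (h : X -> A -> bool) :
  computable_on D l ->
  computable_on (fun y => D y.1 /\ exists l1 l2, l y.1 = l1 ++ y.2 :: l2)
    (fun y => h y.1 y.2) ->
  computable_on D (fun x => has (h x) (l x)).
Proof.
move=> hl hh.
apply: (@computable_on_list_rec _ _ _ _ l (fun x => has (h x))
  (fun y => if h y.1 y.2.1 then true else y.2.2)); [by []|exact: hl|exact: computable_on_const|].
apply: computable_on_if; [|by compute_on..].
apply: (computable_on_comp (f := fun y => (y.1, y.2.1)) hh); first by compute_on.
by move=> x [Dx [l1 [l2 [e _]]]]; split=> //; exists l1, l2.
Qed.

Lemma computable_on_sumn_map (X A : codeType) (D : X -> Prop) (l : X -> seq A)
    (h : X -> A -> nat) :
  computable_on D l ->
  computable_on (fun y => D y.1 /\ exists l1 l2, l y.1 = l1 ++ y.2 :: l2)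
    (fun y => h y.1 y.2) ->
  computable_on D (fun x => sumn (map (h x) (l x))).
Proof.
move=> hl hh.
apply: (@computable_on_list_rec _ _ _ _ l (fun x s => sumn (map (h x) s))
  (fun y => h y.1 y.2.1 + y.2.2)); [by []|exact: hl|exact: computable_on_const|].
apply: computable_on_addn; last by compute_on.
apply: (computable_on_comp (f := fun y => (y.1, y.2.1)) hh); first by compute_on.
by move=> x [Dx [l1 [l2 [e _]]]]; split=> //; exists l1, l2.
Qed.

(** * A self-interpreter *)

Lemma computable_on_subst (X : codeType) (D : X -> Prop) f i g :
  computable_on D f -> computable_on D i -> computable_on D g ->
  computable_on D (fun x => subst (f x) (i x) (g x)).
Proof.
move=> hf hi hg.
apply: (@computable_on2 _ _ _ _ _ (fun y t => subst t y.1 y.2)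
   (fun x => (i x, g x))) => //; last by compute_on.
apply: (@computable_on_term_rec _ _ (fun y t => subst t y.1 y.2)
  (fun y => (y.1.+1, y.2))
  (fun y => if y.2 == y.1.1 then y.1.2 else Var y.2)
  (fun y => App y.2.2.1 y.2.2.2) (fun y => Lam y.2.2)) => //; [by compute_on| |by compute_on..].
by apply: computable_on_if; [apply: computable_on_eqn|..]; compute_on.
Qed.

Definition halts (s : term) : Prop := exists t, evals_to s t.

(** Made total by a classical case distinction; the value on diverging terms is an arbitrary
    default. *)
Definition evalf (s : term) : term :=
  if pselect (halts s) is left h then projT1 (cid h) else s.

Lemma evalfE s t : evals_to s t -> evalf s = t.
Proof.
rewrite /evalf => st; case: pselect => [h|[]]; last by exists t.
by case: cid => t' /= /evals_to_det; apply.
Qed.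

Lemma evalfP s : halts s -> evals_to s (evalf s).
Proof. by move=> [t h]; rewrite (evalfE h). Qed.

(** The interpreter is not structurally recursive, so its correctness is proved by induction on the
    evaluation derivation. It performs [subst] literally on codes, and hence is faithful on open
    terms too, including variable capture. *)
Lemma computable_evalf : computable_on halts evalf.
Proof.
have [ps vs hs] : computable_on xpredT (fun y : term * term => subst y.1 0 y.2).
  by apply: computable_on_subst; compute_on.
have {}hs x := hs x isT.
have /fixpointP[F vF hF] : is_value (Lam (Lam (App (App (App (Var 0)
    (Lam (Var 0)))
    (Lam (Lam (App (App (App (App (Var 3) (Var 1)) (Lam (Var 0))) (Lam (Var 0)))
       (Lam (App (Var 4) (App ps (App (App tpair (Var 0)) (App (Var 4) (Var 1))))))))))
    (Lam (Lam (Lam (Lam (App (Var 0) (Var 3))))))))) by vals.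
have FP s t : evals_to s t -> evals_to (App F (code s)) (code t).
  elim=> {s t} [s|s s1 t t1 u _ IHs _ IHt _ IHu].
    by apply: hF; [vals|]; rewrite code_Lam; ev.
  apply: hF; [vals|]; rewrite code_App.
  eapply evals_to_head; [ev|].
  apply: evals_to_beta; [vals|subs].
  eapply evals_to_head; [ev|].
  apply: evals_to_beta; [vals|subs].
  eapply evals_to_head; [ev|].
  apply: evals_to_beta; [vals|subs].
  eapply evals_to_App; [eapply evals_to_App; [eapply evals_to_App; [exact: IHs|ev|]|ev|]|ev|].
  - by rewrite code_Lam; ev.
  - by ev.
  apply: evals_to_beta; [vals|subs].
  apply: evals_to_beta; [vals|subs].
  apply: evals_to_arg; last exact: IHu.
  apply: evals_to_arg; first (eapply tpairP; [ev|exact: IHt]).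
  exact: hs.
by exists F => // s /evalfP; apply: FP.
Qed.

Lemma computable_on_term_case (X Y : codeType) (D : X -> Prop) (f : term -> Y)
    (fv : nat -> Y) (fa : term * term -> Y) (fl : term -> Y) (t : X -> term) :
  (forall n, f (Var n) = fv n) -> (forall a b, f (App a b) = fa (a, b)) ->
  (forall a, f (Lam a) = fl a) ->
  computable_on xpredT fv -> computable_on xpredT fa -> computable_on xpredT fl ->
  computable_on D t -> computable_on D (fun x => f (t x)).
Proof.
move=> fvE faE flE hv ha hl ht.
apply: (@computable_on2 _ nat_code _ _ _ (fun _ => f) (fun=> 0));
  [|exact: computable_on_const|exact: ht].
apply: (@computable_on_term_rec _ _ (fun _ => f) (fun n => n) (fun y => fv y.2)
  (fun y => fa y.2.1) (fun y => fl y.2.1)) => //.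
- by compute_on.
- by apply: (computable_on1 hv); compute_on.
- by apply: (computable_on1 ha); compute_on.
- by apply: (computable_on1 hl); compute_on.
Qed.

Definition app_fun t := if t is App a _ then a else t.
Definition app_arg t := if t is App _ b then b else t.
Definition lam_body t := if t is Lam a then a else t.
Definition is_enc_true t := if t is Lam (Lam (Var n)) then n == 1 else false.

Lemma computable_on_app_fun (X : codeType) (D : X -> Prop) t :
  computable_on D t -> computable_on D (fun x => app_fun (t x)).
Proof.
apply: (@computable_on_term_case _ _ _ app_fun Var fst Lam) => //;
  [apply: (computable_on_Var (f := fun n => n))|
  |apply: (computable_on_Lam (f := fun n => n))]; compute_on.
Qed.

Lemma computable_on_app_arg (X : codeType) (D : X -> Prop) t :
  computable_on D t -> computable_on D (fun x => app_arg (t x)).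
Proof.
apply: (@computable_on_term_case _ _ _ app_arg Var snd Lam) => //;
  [apply: (computable_on_Var (f := fun n => n))|
  |apply: (computable_on_Lam (f := fun n => n))]; compute_on.
Qed.

Lemma computable_on_lam_body (X : codeType) (D : X -> Prop) t :
  computable_on D t -> computable_on D (fun x => lam_body (t x)).
Proof.
apply: (@computable_on_term_case _ _ _ lam_body Var (fun y => App y.1 y.2) (fun a => a))
  => //; [apply: (computable_on_Var (f := fun n => n))|..]; compute_on.
Qed.

Lemma computable_on_is_enc_true (X : codeType) (D : X -> Prop) t :
  computable_on D t -> computable_on D (fun x => is_enc_true (t x)).
Proof.
pose f0 t0 := if t0 is Var n then n == 1 else false.
pose f1 t1 := if t1 is Lam a then f0 a else false.
have h0 : computable_on xpredT f0.
  apply: (@computable_on_term_case _ _ _ f0 (fun n => n == 1) (fun=> false)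
    (fun=> false) (fun t => t)) => //; do ?by compute_on.
  by apply: computable_on_eqn; compute_on.
have h1 : computable_on xpredT f1.
  by apply: (@computable_on_term_case _ _ _ f1 (fun=> false) (fun=> false)
    f0 (fun t => t)) => //; compute_on.
apply: (@computable_on_term_case _ _ _ is_enc_true (fun=> false) (fun=> false) f1)
  => //; compute_on.
Qed.

Fixpoint term_size t := match t with
  | Var _ => 0
  | App a b => (term_size a + term_size b).+1
  | Lam a => (term_size a).+1
  end.

Lemma computable_on_term_size (X : codeType) (D : X -> Prop) t :
  computable_on D t -> computable_on D (fun x => term_size (t x)).
Proof.
apply: (@computable_on2 _ nat_code _ _ _ (fun _ => term_size) (fun=> 0));
  last exact: computable_on_const.
apply: (@computable_on_term_rec _ _ (fun _ => term_size) (fun n => n)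
  (fun=> 0) (fun y => (y.2.2.1 + y.2.2.2).+1) (fun y => y.2.2.+1)) => //; compute_on.
by apply: computable_on_addn; compute_on.
Qed.

(** Bounds an encoded number without decoding it. Overestimating is harmless, since a truncation
    depth may always be increased. *)
Lemma term_size_enc_nat n : n <= term_size (enc_nat n).
Proof. by elim: n => //= n IH; rewrite add0n ltnS (leq_trans IH) // -addn2 leq_addr. Qed.

(** Quotation: here [code (f x)] is itself data, a syntax tree. It serves to build the arguments of
    Alice's programs for the interpreter. *)
Lemma computable_on_code_nat (X : codeType) (D : X -> Prop) (f : X -> nat) :
  computable_on D f -> computable_on D (fun x => code (f x)).
Proof.
apply: (@computable_on1 _ nat_code term_code _ (fun n => code n)).
by apply: (@computable_on_nat_rec nat_code term_code xpredT (fun n => n)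
  (fun _ n => code n) (fun y => Lam (Lam (App (Var 0) y.2.2)))) => //; compute_on.
Qed.

Lemma computable_on_code_seq (X : codeType) (D : X -> Prop) (f : X -> seq nat) :
  computable_on D f -> computable_on D (fun x => code (f x)).
Proof.
apply: (@computable_on1 _ (seq_code nat_code) term_code _ (fun l => code l)).
apply: (@computable_on_list_rec (seq_code nat_code) nat_code term_code xpredT
  (fun l => l) (fun _ l => code l)
  (fun y => Lam (Lam (App (App (Var 0) (code y.2.1)) y.2.2)))) => //; compute_on.
by apply: computable_on_code_nat; compute_on.
Qed.

(** * Bob's algorithm *)

(** These are the positions at which Alice has moved by the time Bob leaves [v]. The structural form
    fits list recursion. *)
Fixpoint prefixes (v : seq nat) : seq (seq nat) :=
  if v is a :: v' then [::] :: [seq a :: w | w <- prefixes v'] else [:: [::]].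

Lemma prefixesE v : prefixes v = [seq take j v | j <- iota 0 (size v).+1].
Proof.
elim: v => // a v IH; rewrite [LHS]/= IH [size _]/=.
rewrite -[iota 0 (size v).+2]/(0 :: iota (1 + 0) (size v).+1) iotaDl map_cons.
by rewrite -!map_comp.
Qed.

Lemma computable_on_prefixes (X : codeType) (D : X -> Prop) (f : X -> seq nat) :
  computable_on D f -> computable_on D (fun x => prefixes (f x)).
Proof.
apply: (@computable_on1 _ (seq_code nat_code) (seq_code (seq_code nat_code))).
apply: (@computable_on_list_rec (seq_code nat_code) nat_code
  (seq_code (seq_code nat_code)) xpredT (fun l => l) (fun _ l => prefixes l)
  (fun y => [::] :: [seq y.2.1 :: w | w <- y.2.2])) => //; compute_on.
apply: (@computable_on_map _ _ _ _ (fun y => y.2.2) (fun y w => y.2.1 :: w));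
  by compute_on.
Qed.

Section Bob.
(** [s] is the program of Alice's strategy, and [a r / d r] is the approximation of [beta] with
    error at most [2 ^- r]. Vertices are represented by lists of natural numbers. *)
Variables (k : nat) (s : term) (a d : nat -> nat).

(** Since [enc_pair p m] is [Lam (App (App (Var 0) p) m)], both programs can be read off the syntax
    of its body. *)
Definition strategy_output v := lam_body (evalf (App s (code (v : seq nat)))).
Definition decider v := app_arg (app_fun (strategy_output v)).
Definition modulus v := app_arg (strategy_output v).
(** For positive [M] this is the encoding of the rational [1 / M], spelled out so that its syntax is
    easily computed from [M]. *)
Definition enc_inv (M : nat) : term :=
  Lam (App (App (Var 0) (code (Posz 1))) (Lam (Lam (App (Var 1) (code M))))).

(* Membership of [u] in the set of the vertices that are forbidden once Alice
   has moved at [v]. *)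
Definition in_forbidden (v u : seq nat) :=
  has (fun w => is_enc_true (evalf (App (decider w) (code u)))) (prefixes v).

(* Every modulus answer [N] is at most the size of its encoding, so that the
   weight of each of Alice's sets beyond this depth is less than [1 / M]. *)
Definition tail_depth (v : seq nat) M :=
  sumn [seq size w + term_size (evalf (App (modulus w) (enc_inv M)))
       | w <- prefixes v].

Fixpoint words j : seq (seq nat) :=
  if j is j'.+1 then flatten [seq [seq i :: x | x <- words j'] | i <- iota 0 k]
  else [:: [::]].

Definition forbidden_count v w j :=
  sumn [seq if in_forbidden v (w ++ x) then 1 else 0 | x <- words j].

(* [P ^ n * \sum_(j <= n) forbidden_count v w j * (S / P) ^ j] *)
Fixpoint scaled_load v w P S n :=
  if n is n'.+1 then
    P * scaled_load v w P S n' + S ^ n * forbidden_count v w n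
  else forbidden_count v w 0.

(* [y = (v, n)] stands for the child number [n %% k] of [v], tested with
   precision [n]. *)
Definition child (y : seq nat * nat) := rcons y.1 (y.2 %% k).
(** Let [w] be the child and [n = y.2]. Each of the [size w] moves made before Bob arrives at [w]
    has a tail of weight at most [1 / M], which grows by a factor of at most
    [beta ^ size w <= k ^ size w] when measured at [w]. With this [M] the tails add up to at most
    [1 / (n + 1)]. *)
Definition tail_precision y := y.2.+1 * (size (child y) * k ^ size (child y)).
Definition test_depth y := tail_depth y.1 (tail_precision y).
(* The depth enters so that [(beta / b) ^ test_depth y] tends to [1]. *)
Definition beta_precision y := (test_depth y + y.2).+1.
(* The lower bound [b = q r - 2 ^- r] of [beta], for [q r = a r / d r]. *)
Definition beta_num y :=
  a (beta_precision y) * 2 ^ beta_precision y - d (beta_precision y).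
Definition beta_den y := d (beta_precision y) * 2 ^ beta_precision y.
(** With [D] the depth, [b = P / S] and [T] the load truncated at [D] in base [b], this is
    [T < n / (n + 1)] multiplied by [P ^ D * (n + 1)]. The margin [1 / (n + 1)] below [1] is
    reserved for the tail. *)
Definition light_test y :=
  scaled_load y.1 (child y) (beta_num y) (beta_den y) (test_depth y) * y.2.+1
    < y.2 * beta_num y ^ test_depth y.

(** To be instantiated by the lists that represent alive vertices. *)
Variable good : seq nat -> Prop.
Hypothesis k_gt0 : 0 < k.
Hypothesis good_take : forall v j, good v -> good (take j v).
Hypothesis strategy_halts : forall v, good v -> halts (App s (code v)).
Hypothesis decider_halts : forall v u, good v -> all (gtn k) u ->
  halts (App (decider v) (code u)).
Hypothesis modulus_halts : forall v M, good v -> 0 < M ->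
  halts (App (modulus v) (enc_inv M)).
Hypothesis a_computable : computable_on xpredT a.
Hypothesis d_computable : computable_on xpredT d.
Hypothesis good_all : forall v, good v -> all (gtn k) v.

Lemma good_prefixes v w : good v -> w \in prefixes v -> good w.
Proof. by move=> gv; rewrite prefixesE => /mapP[j _ ->]; apply: good_take. Qed.

Lemma computable_strategy_output : computable_on good strategy_output.
Proof.
apply: computable_on_lam_body.
apply: (@computable_on_comp _ _ _ _ _ (fun v => App s (code v)) _ computable_evalf).
  by compute_on; apply: computable_on_code_seq; compute_on.
exact: strategy_halts.
Qed.

Lemma computable_in_forbidden :
  computable_on (fun y => good y.1 /\ all (gtn k) y.2)
    (fun y => in_forbidden y.1 y.2).
Proof.
apply: (@computable_on_has _ _ _ (fun y => prefixes y.1)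
  (fun y w => is_enc_true (evalf (App (decider w) (code y.2))))).
  by apply: computable_on_prefixes; compute_on.
apply: computable_on_is_enc_true.
have gw (x : (seq nat * seq nat) * seq nat) :
    (good x.1.1 /\ all (gtn k) x.1.2) /\
    (exists l1 l2, prefixes x.1.1 = l1 ++ x.2 :: l2) -> good x.2.
  move=> [[gv _] [l1 [l2 e]]]; apply: (good_prefixes gv).
  by rewrite e mem_cat mem_head orbT.
apply: (@computable_on_comp _ _ _ _ _
  (fun x => App (decider x.2) (code x.1.2)) _ computable_evalf).
  compute_on.
    apply: computable_on_app_arg; apply: computable_on_app_fun.
    apply: (computable_on_comp (f := snd) computable_strategy_output) => //.
    by compute_on.
  by apply: computable_on_code_seq; compute_on.
by move=> x h; apply: decider_halts (gw _ h) _; case: h => -[].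
Qed.

Lemma computable_tail_depth :
  computable_on (fun y => good y.1 /\ 0 < y.2) (fun y => tail_depth y.1 y.2).
Proof.
apply: (@computable_on_sumn_map _ _ _ (fun y => prefixes y.1)
  (fun y w => size w + term_size (evalf (App (modulus w) (enc_inv y.2))))).
  by apply: computable_on_prefixes; compute_on.
have gw (x : (seq nat * nat) * seq nat) :
    (good x.1.1 /\ 0 < x.1.2) /\
    (exists l1 l2, prefixes x.1.1 = l1 ++ x.2 :: l2) -> good x.2.
  move=> [[gv _] [l1 [l2 e]]]; apply: (good_prefixes gv).
  by rewrite e mem_cat mem_head orbT.
apply: computable_on_addn; first by apply: computable_on_size; compute_on.
apply: computable_on_term_size.
apply: (@computable_on_comp _ _ _ _ _
  (fun x => App (modulus x.2) (enc_inv x.1.2)) _ computable_evalf).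
  rewrite /enc_inv; compute_on.
    apply: computable_on_app_arg.
    apply: (computable_on_comp (f := snd) computable_strategy_output) => //.
    by compute_on.
  by apply: computable_on_code_nat; compute_on.
by move=> x h; apply: modulus_halts (gw _ h) _; case: h => -[].
Qed.

Lemma all_words j : all (all (gtn k)) (words j).
Proof.
elim: j => //= j IH; apply/allP => x /flattenP[_ /mapP[i ik ->] /mapP[y yw ->]] /=.
by move: ik; rewrite mem_iota add0n => /andP[_ ->]; apply: (allP IH).
Qed.

Lemma computable_words : computable_on xpredT words.
Proof.
apply: (@computable_on_nat_rec _ (seq_code (seq_code nat_code)) _ (fun n => n)
  (fun _ n => words n)
  (fun y => flatten [seq [seq i :: x | x <- y.2.2] | i <- iota 0 k])) => //;
  do ?by compute_on.
apply: (@computable_on_list_rec _ nat_code (seq_code (seq_code nat_code)) _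
   (fun=> iota 0 k) (fun y l => flatten [seq [seq i :: x | x <- y.2.2] | i <- l])
   (fun z => [seq z.2.1 :: x | x <- z.1.2.2] ++ z.2.2));
   [by []|by compute_on|exact: computable_on_const|].
apply: computable_on_cat; last by compute_on.
by apply: (@computable_on_map _ _ _ _ (fun z => z.1.2.2) (fun z x => z.2.1 :: x));
  compute_on.
Qed.

Lemma computable_forbidden_count :
  computable_on
    (fun y : (seq nat * seq nat) * nat => good y.1.1 /\ all (gtn k) y.1.2)
    (fun y => forbidden_count y.1.1 y.1.2 y.2).
Proof.
apply: (@computable_on_sumn_map _ _ _ (fun y => words y.2)
  (fun y x => if in_forbidden y.1.1 (y.1.2 ++ x) then 1 else 0)).
  by apply: (computable_on1 computable_words); compute_on.
apply: computable_on_if; [|by compute_on..].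
apply: (@computable_on_comp _ _ _ _ _ (fun y => (y.1.1.1, y.1.1.2 ++ y.2)) _
  computable_in_forbidden).
  by compute_on; apply: computable_on_cat; compute_on.
move=> x [[gv aw] [l1 [l2 e]]]; split => //=; rewrite all_cat aw /=.
by apply: (allP (all_words x.1.2)); rewrite e mem_cat mem_head orbT.
Qed.

Lemma computable_scaled_load :
  computable_on (fun y : ((seq nat * seq nat) * (nat * nat)) * nat =>
       good y.1.1.1 /\ all (gtn k) y.1.1.2)
    (fun y => scaled_load y.1.1.1 y.1.1.2 y.1.2.1 y.1.2.2 y.2).
Proof.
apply: (@computable_on_nat_rec _ nat_code _ (fun y => y.2)
  (fun y n => scaled_load y.1.1.1 y.1.1.2 y.1.2.1 y.1.2.2 n)
  (fun z => z.1.1.2.1 * z.2.2 +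
     z.1.1.2.2 ^ z.2.1.+1 * forbidden_count z.1.1.1.1 z.1.1.1.2 z.2.1.+1)) => //.
- by compute_on.
- apply: (@computable_on_comp _ _ _ _ _ (fun y => (y.1.1, 0)) _
    computable_forbidden_count) => //.
  by compute_on.
apply: computable_on_addn; first by apply: computable_on_muln; compute_on.
apply: computable_on_muln; first by apply: computable_on_expn; compute_on.
apply: (@computable_on_comp _ _ _ _ _ (fun z => (z.1.1.1, z.2.1.+1)) _
    computable_forbidden_count) => //; first by compute_on.
by move=> x [].
Qed.

Lemma tail_precision_gt0 y : 0 < tail_precision y.
Proof. by rewrite /tail_precision /child size_rcons !muln_gt0 expn_gt0 k_gt0. Qed.

Lemma computable_light_test : computable_on (fun y => good y.1) light_test.
Proof.
have hc : computable_on (fun y => good y.1) child.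
  apply: computable_on_rcons; first by compute_on.
  by apply: computable_on_modn => //; compute_on.
have hs : computable_on (fun y => good y.1) (fun y => size (child y)).
  exact: computable_on_size.
have hM : computable_on (fun y => good y.1) tail_precision.
  apply: computable_on_muln; first by compute_on.
  by apply: computable_on_muln => //; apply: computable_on_expn => //; compute_on.
have hD : computable_on (fun y => good y.1) test_depth.
  apply: (@computable_on_comp _ _ _ _ _ (fun y => (y.1, tail_precision y)) _
    computable_tail_depth); first by compute_on.
  by move=> y gy; split=> //; exact: tail_precision_gt0.
have hr : computable_on (fun y => good y.1) beta_precision.
  by apply: computable_on_succ; apply: computable_on_addn => //; compute_on.
have h2 : computable_on (fun y => good y.1) (fun y => 2 ^ beta_precision y).
  by apply: computable_on_expn => //; compute_on.
have hd := computable_on1 d_computable hr.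
have hP : computable_on (fun y => good y.1) beta_num.
  apply: computable_on_subn => //; apply: computable_on_muln => //.
  exact: computable_on1 a_computable hr.
have hS : computable_on (fun y => good y.1) beta_den.
  exact: computable_on_muln.
apply: computable_on_leq; last first.
  by apply: computable_on_muln; [compute_on|apply: computable_on_expn].
apply: computable_on_succ; apply: computable_on_muln; last by compute_on.
apply: (@computable_on_comp _ _ _ _ _
  (fun y => (((y.1, child y), (beta_num y, beta_den y)), test_depth y)) _
  computable_scaled_load); first by compute_on.
move=> y gy; split => //=; rewrite /child all_rcons /= ltn_pmod //=.
exact: good_all.
Qed.

End Bob.

(** * The weight of the forbidden set *)

Import Order.TTheory GRing.Theory Num.Theory.
Local Open Scope classical_set_scope.
Local Open Scope ring_scope.

(** Both inequalities come from one estimate, applied to [c] and to [c^-1]. *)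
Lemma esumZl (R : realType) (T : choiceType) (c : R) (S : set T) (a : T -> \bar R) :
  0 < c -> (forall t, 0 <= a t)%E ->
  (\esum_(t in S) (c%:E * a t) = c%:E * \esum_(t in S) a t)%E.
Proof.
have le_Z (d : R) (b : T -> \bar R) : 0 < d -> (forall t, 0 <= b t)%E ->
    (\esum_(t in S) (d%:E * b t) <= d%:E * \esum_(t in S) b t)%E.
  move=> d0 b0; apply: ge_ereal_sup => _ [X [finX XS] <-].
  rewrite -ge0_mule_fsumr //; apply: lee_wpmul2l; first by rewrite lee_fin ltW.
  by apply: esum_ge; exists X.
move=> c0 a0; apply/le_anti; rewrite le_Z //= -lee_pdivlMl ?invr_gt0 //.
apply: le_trans (le_Z _ _ _ _) => //; last first.
- by move=> t; rewrite mule_ge0 // lee_fin ltW.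
- by rewrite invr_gt0.
by apply: le_esum => t _; rewrite muleA -EFinM mulVf ?gt_eqF // mul1e.
Qed.

Section Load.
Variables (R : realType) (beta : R) (k : nat).
Hypothesis beta_gt1 : 1 < beta.
Implicit Types (u v w : vertex k) (A B : set (vertex k)).

Let beta_gt0 : 0 < beta. Proof. exact: lt_trans beta_gt1. Qed.

Definition subtree v : set (vertex k) := [set u | prefix v u].

(** Bob's invariant is that the forbidden set has load less than [1] at his position. *)
Definition load A v : \bar R := weight beta v (A `&` subtree v).

Lemma weight_mkcond v A : weight beta v A =
  (\esum_(u in setT) if u \in A then (beta ^- (size u - size v)%N)%:E else 0)%E.
Proof. exact: esum_mkcond. Qed.

Lemma weight_ge0 v A : (0 <= weight beta v A)%E.
Proof. by apply: esum_ge0 => u _; rewrite lee_fin invr_ge0 exprn_ge0 ?ltW. Qed.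

Lemma load_ge0 A v : (0 <= load A v)%E. Proof. exact: weight_ge0. Qed.

Lemma weight_sub v A B : A `<=` B -> (weight beta v A <= weight beta v B)%E.
Proof.
move=> AB; rewrite !weight_mkcond; apply: le_esum => u _.
case: ifPn => [/set_mem/AB/mem_set -> //|_].
by case: ifP => // _; rewrite lee_fin invr_ge0 exprn_ge0 ?ltW.
Qed.

Lemma weightU v A B :
  (weight beta v (A `|` B) <= weight beta v A + weight beta v B)%E.
Proof.
have f0 (u : vertex k) : (0 <= (beta ^- (size u - size v)%N)%:E)%E.
  by rewrite lee_fin invr_ge0 exprn_ge0 ?ltW.
rewrite !weight_mkcond -esumD; do ?by move=> u _; case: ifP.
apply: le_esum => u _; rewrite in_setU.
by case: (u \in A); case: (u \in B) => //=; rewrite ?adde0 ?add0e ?leeDl.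
Qed.

Lemma weight_bigcup v n (F : nat -> set (vertex k)) :
  (weight beta v (\bigcup_(j in [set j | (j < n)%N]) F j)
     <= \sum_(j < n) weight beta v (F j))%E.
Proof.
elim: n => [|n IH].
  rewrite big_ord0 (_ : \bigcup_(_ in _) _ = set0).
    by rewrite /weight esum_set0.
  by apply/seteqP; split => // u [].
rewrite big_ord_recr /=; apply: le_trans (leeD2r _ IH).
apply: le_trans (weightU _ _ _); apply: weight_sub => u [j /= jn Fu].
move: jn; rewrite ltnS leq_eqVlt => /orP[/eqP <-|jn]; first by right.
by left; exists j.
Qed.

(** Only the levels of [v] and [w] matter. The lower bound on [size u] keeps the natural
    subtractions in the exponents from truncating. *)
Lemma weight_shift v w d A : size w = (size v + d)%N ->
  (forall u, A u -> (size w <= size u)%N) ->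
  (weight beta w A = (beta ^+ d)%:E * weight beta v A)%E.
Proof.
move=> wv Aw; rewrite /weight -esumZl ?exprn_gt0 //; last first.
  by move=> u; rewrite lee_fin invr_ge0 exprn_ge0 ?ltW.
apply: eq_esum => u /Aw; rewrite wv => le_u; rewrite -EFinM; congr EFin.
rewrite subnDA -[in RHS](subnK (_ : (d <= size u - size v)%N)); last first.
  by rewrite leq_subRL // (leq_trans _ le_u) // leq_addr.
by rewrite exprD invfM mulrCA divff ?mulr1 // expf_neq0 // gt_eqF.
Qed.

Lemma prefix_rcons_cat v i j u : prefix (rcons v i) (v ++ j :: u) = (i == j).
Proof. by elim: v => [|a v IH] /=; rewrite ?prefix0s ?andbT // eqxx IH. Qed.

(** A vertex of the subtree is either [v], of weight [1], or lies below exactly one child, where its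
    weight is [beta] times larger. *)
Lemma load_rec A v : (load A v = (`[< A v >]%:R)%:E +
  (beta^-1)%:E * \sum_(i < k) load A (rcons v i))%E.
Proof.
have f0 (u : vertex k) n : (0 <= (beta ^- (size u - n)%N)%:E)%E.
  by rewrite lee_fin invr_ge0 exprn_ge0 ?ltW.
rewrite {1}/load /weight (esumID [set v]) //; congr (_ + _)%E.
  case: asboolP => Av.
    rewrite (_ : _ `&` [set v] = [set v]); last first.
      apply/seteqP; split => u; first by case.
      by move=> ->; split => //; split => //; exact: prefix_refl.
    by rewrite esum_set1 ?subnn ?expr0 ?invr1.
  rewrite (_ : _ `&` [set v] = set0) ?esum_set0 //.
  by apply/seteqP; split => // u [[Au _] uv]; apply: Av; rewrite -uv.
transitivity (\sum_(i < k) weight beta v (A `&` subtree (rcons v i)))%E.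
  under eq_bigr do rewrite weight_mkcond.
  rewrite -esum_sum; last by move=> u i _ _; case: ifP.
  rewrite esum_mkcond; apply: eq_esum => u _.
  case: ifPn => [/set_mem [[Au /prefixP[x ux]] uv]|uP].
    case: x ux => [|j x] ux; first by rewrite cats0 in ux.
    (* The first letter [j] after [v] singles out the only child whose subtree contains [u]. *)
    rewrite (bigD1 j) //= ifT; last first.
      by apply/mem_set; split; rewrite // /subtree /= ux prefix_rcons_cat.
    rewrite big1 ?adde0 // => i ij; rewrite ifF //; apply/negbTE/negP.
    move=> /set_mem[_]; rewrite /subtree /= ux prefix_rcons_cat => /eqP ei.
    by rewrite ei eqxx in ij.
  rewrite big1 // => i _; rewrite ifF //; apply/negbTE; apply: contra uP.
  move=> /set_mem[Au]; rewrite /subtree /= => /prefixP[x ux].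
  apply/mem_set; split; last first.
    by move=> /= uv; have := congr1 size ux;
       rewrite uv size_cat size_rcons => /eqP; rewrite addSnnS -{1}[size v]addn0 eqn_add2l.
  by split => //; rewrite /subtree /= ux cat_rcons; exact: prefix_prefix.
rewrite ge0_sume_distrr; last by move=> i _; exact: load_ge0.
apply: eq_bigr => i _; rewrite /load (@weight_shift v (rcons v i) 1).
- by rewrite muleA -EFinM expr1 mulVf ?mul1e // gt_eqF.
- by rewrite size_rcons addn1.
- by move=> u [_]; exact: size_prefix.
Qed.

Lemma load_self A v : A v -> (1 <= load A v)%E.
Proof.
move=> Av; rewrite load_rec; case: asboolP => // _.
rewrite leeDl //; apply: mule_ge0; first by rewrite lee_fin invr_ge0 ltW.
by apply: sume_ge0 => i _; exact: load_ge0.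
Qed.

(** If every child had load at least [1], then [load_rec] would give a load of at least
    [k / beta >= 1 + omega] at [v]. *)
Lemma exists_light_child (omega : R) A v : beta * (1 + omega) <= k%:R ->
  (load A v < (1 + omega)%:E)%E -> exists i, (load A (rcons v i) < 1)%E.
Proof.
move=> bk lv; apply: contrapT => no.
suff : ((1 + omega)%:E <= load A v)%E by rewrite leNgt lv.
rewrite load_rec; apply: (@le_trans _ _ ((beta^-1)%:E * \sum_(i < k) 1)%E).
  rewrite sumEFin -EFinM lee_fin big_const_ord iter_addr_0.
  by rewrite mulrC ler_pdivlMr // mulrC.
rewrite -[leLHS]add0e; apply: leeD; first by rewrite lee_fin; case: asboolP.
apply: lee_wpmul2l; first by rewrite lee_fin invr_ge0 ltW.
apply: lee_sum => i _; rewrite leNgt; apply/negP => li.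
by apply: no; exists i.
Qed.

(** Recursion through the children, in place of a cardinality, matches both [load_rec] and the
    enumeration [words]. *)
Fixpoint level_count A v j : nat :=
  if j is j'.+1 then \sum_(i < k) level_count A (rcons v i) j'
  else `[< A v >].

(** The base [b] is independent of [beta] because Bob computes with a rational lower bound of
    [beta], which can only overestimate weights. *)
Definition truncated_load (b : R) A v n : R :=
  \sum_(j < n.+1) (level_count A v j)%:R * b ^- j.

Lemma truncated_load_rec b A v n : truncated_load b A v n.+1 =
  `[< A v >]%:R + b^-1 * \sum_(i < k) truncated_load b A (rcons v i) n.
Proof.
rewrite /truncated_load big_ord_recl /= expr0 invr1 mulr1; congr (_ + _).
rewrite exchange_big /= mulr_sumr; apply: eq_bigr => j _.
rewrite natr_sum mulr_suml mulr_sumr; apply: eq_bigr => i _.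
by rewrite /bump /= exprS invfM mulrCA.
Qed.

Lemma load_truncate A v n :
  load (A `&` [set u | (size u <= size v + n)%N]) v = (truncated_load beta A v n)%:E.
Proof.
elim: n v => [|n IH] v; rewrite load_rec.
  rewrite big1 ?mule0 ?adde0 => [|i _]; last first.
    rewrite /load (_ : _ `&` _ = set0) ?/weight ?esum_set0 //.
    apply/seteqP; split => // u [[_ /= uv] /size_prefix].
    by rewrite size_rcons ltnNge -{1}[size v]addn0 uv.
  rewrite /truncated_load big_ord_recl big_ord0 addr0 expr0 invr1 mulr1 /=.
  congr (_%:R%:E); congr nat_of_bool.
  by apply/asboolP/asboolP => [[]//|Av]; split => //=; rewrite addn0.
rewrite truncated_load_rec EFinD EFinM -sumEFin; congr (_ + _ * _)%E.
  congr (_%:R%:E); congr nat_of_bool.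
  by apply/asboolP/asboolP => [[]//|Av]; split => //=; rewrite leq_addr.
by apply: eq_bigr => i _; rewrite -IH size_rcons addSnnS.
Qed.

Lemma truncated_load_le_load A v n : ((truncated_load beta A v n)%:E <= load A v)%E.
Proof. by rewrite -load_truncate; apply: weight_sub => u [[]]. Qed.

Lemma truncated_load_ge b A v n : 0 < b -> b <= beta ->
  truncated_load beta A v n <= truncated_load b A v n.
Proof.
move=> b0 bb; apply: ler_sum => j _; rewrite ler_wpM2l // lef_pV2 ?posrE ?exprn_gt0 //.
by apply: lerXn2r => //; rewrite nnegrE ltW.
Qed.

(** Level [j] is overestimated by the factor [(beta / b) ^ j], which is at most [(beta / b) ^ n]. *)
Lemma truncated_load_le b A v n : 0 < b -> b <= beta ->
  truncated_load b A v n <= (beta / b) ^+ n * truncated_load beta A v n.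
Proof.
move=> b0 bb; rewrite /truncated_load mulr_sumr; apply: ler_sum => j _.
rewrite mulrCA ler_wpM2l //.
have bj : 0 < beta ^+ j by rewrite exprn_gt0.
rewrite ler_pdivlMr // mulrC -[X in X <= _]expr_div_n ler_weXn2l //.
  by rewrite ler_pdivlMr // mul1r.
by rewrite -ltnS ltn_ord.
Qed.

(** * Loads of the set forbidden by a strategy *)

Section Forbidden.
Variable sigma : strategy k.

(** Alice's move at [v] itself is included, and the right-hand side does not mention [i]: all
    children of [v] face the same forbidden set. *)
Lemma forbidden_rcons v i u : forbidden sigma (rcons v i) u <->
  exists2 j, (j <= size v)%N & sigma (take j v) u.
Proof.
split=> [[j /=]|[j jv su]].
  by rewrite size_rcons ltnS => jv; rewrite -cats1 takel_cat // => su; exists j.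
exists j; rewrite /= ?size_rcons ?ltnS // -cats1 takel_cat //.
Qed.

(** A forbidden vertex deeper than [size w + n] lies in the tail [F j] of one of the [size w]
    earlier moves. Measured at [w], such a tail grows by [beta ^ (size w - j) <= beta ^ size w]. *)
Lemma load_forbidden_le v i w n (e : R) : w = rcons v i ->
  (forall j, (j <= size v)%N -> (weight beta (take j v)
     (sigma (take j v) `&` [set u | (n < size u)%N]) <= e%:E)%E) ->
  (load (forbidden sigma w) w <=
   (truncated_load beta (forbidden sigma w) w n +
    (size w)%:R * (beta ^+ size w * e))%:E)%E.
Proof.
move=> wE he; set A := forbidden _ _.
pose F j := sigma (take j v) `&` [set u | (n < size u)%N] `&` subtree w.
have Fe j : (j < size w)%N -> (weight beta w (F j) <= (beta ^+ size w * e)%:E)%E.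
  rewrite {1}wE size_rcons ltnS => jv.
  rewrite (@weight_shift (take j v) w (size w - j)%N); first last.
  - by move=> u [_]; exact: size_prefix.
  - by rewrite size_take_min (minn_idPl jv) subnKC // wE size_rcons ltnW.
  have h : (weight beta (take j v) (F j) <= e%:E)%E.
    by apply: le_trans (he _ jv); apply: weight_sub => u [].
  have e0 : (0 <= e%:E)%E by apply: le_trans h; exact: weight_ge0.
  apply: (@le_trans _ _ ((beta ^+ (size w - j))%:E * e%:E)%E).
    by apply: lee_wpmul2l => //; rewrite lee_fin exprn_ge0 ?ltW.
  rewrite -EFinM lee_fin ler_wpM2r // ler_weXn2l ?leq_subr // ltW //.
rewrite EFinD -load_truncate.
apply: (@le_trans _ _ (weight beta w ((A `&` [set u | (size u <= size w + n)%N]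
   `&` subtree w) `|` \bigcup_(j in [set j | (j < size w)%N]) F j))).
  apply: weight_sub => u [Au wu].
  have [un|un] := leqP (size u) (size w + n); first by left; split.
  have [j jv su] : exists2 j, (j <= size v)%N & sigma (take j v) u.
    by apply/(forbidden_rcons v i); rewrite -wE.
  right; exists j; first by rewrite /= wE size_rcons ltnS.
  split; last by [].
  by split; rewrite //= (leq_ltn_trans _ un) // leq_addl.
apply: le_trans (weightU _ _ _) _; rewrite leeD2l //.
apply: le_trans (weight_bigcup _ _ _) _.
apply: (@le_trans _ _ (\sum_(j < size w) (beta ^+ size w * e)%:E)%E).
  by apply: lee_sum => j _; exact: Fe.
by rewrite sumEFin lee_fin big_const_ord iter_addr_0 mulr_natl.
Qed.

Lemma alive_take v j : alive sigma v -> alive sigma (take j v).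
Proof.
move=> av i; rewrite size_take_min leq_min => /andP[ij iv].
by rewrite take_takel //; apply: av.
Qed.

Lemma alive_rcons v i : alive sigma v ->
  (load (forbidden sigma (rcons v i)) (rcons v i) < 1)%E -> alive sigma (rcons v i).
Proof.
move=> av lw j; rewrite size_rcons leq_eqVlt => /orP[/eqP->|jv].
  rewrite take_oversize ?size_rcons // => fw.
  by move: (load_self fw); rewrite leNgt lw.
by rewrite -cats1 takel_cat //; apply: av.
Qed.

Lemma legal_light_child (omega : R) v : beta * (1 + omega) <= k%:R ->
  legal_strategy beta omega sigma -> alive sigma v ->
  (load (forbidden sigma v) v < 1)%E ->
  exists i, (load (forbidden sigma (rcons v i)) (rcons v i) < 1)%E.
Proof.
move=> bk leg av lv; have [sub _ wo] := leg _ av.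
have [|i hi] := @exists_light_child omega (forbidden sigma v `|` sigma v) v bk.
  apply: (@le_lt_trans _ _ (load (forbidden sigma v) v + weight beta v (sigma v))%E).
    rewrite /load setIUl; apply: le_trans (weightU _ _ _) _; rewrite leeD2l //.
    by apply: weight_sub => u [].
  have fin : load (forbidden sigma v) v \is a fin_num.
    by rewrite ge0_fin_numE ?load_ge0 // (lt_trans lv) // ltry.
  apply: le_lt_trans (leeD2l _ wo) _; rewrite EFinD lteD2rE //.
exists i; rewrite (_ : forbidden _ _ = forbidden sigma v `|` sigma v) //.
apply/seteqP; split => u.
  move=> /forbidden_rcons[j]; rewrite leq_eqVlt => /orP[/eqP ->|jv su].
    by rewrite take_size => su; right.
  by left; exists j.
move=> [[j jv su]|su]; apply/forbidden_rcons.
  by exists j => //; exact: ltnW.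
by exists (size v); rewrite ?take_size.
Qed.

End Forbidden.
End Load.

(** * Correctness of Bob's algorithm *)

Definition nat_seq (k : nat) (v : vertex k) : seq nat := [seq nat_of_ord i | i <- v].

Lemma enc_vertexE k (v : vertex k) : enc_vertex v = code (nat_seq v).
Proof. by rewrite /enc_vertex /code /= -map_comp. Qed.

Lemma enc_invE M : (0 < M)%N -> enc_inv M = enc_rat (M%:R^-1).
Proof.
move=> M0; rewrite /enc_inv /enc_rat -[M%:R^-1]mul1r -[M%:R]/(M%:~R).
rewrite -[X in X / _]/(1%:~R) coprimeq_num ?coprimeq_den ?coprime1n //.
by rewrite gtr0_sg ?ltz_nat // mulr1 gt_eqF.
Qed.

Lemma bernoulli (R : realDomainType) (x : R) n : 0 <= x <= 1 ->
  1 - n%:R * x <= (1 - x) ^+ n.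
Proof.
move=> /andP[x0 x1]; elim: n => [|n IH]; first by rewrite expr0 mul0r subr0.
rewrite exprS; apply: le_trans (ler_wpM2l _ IH); last by rewrite subr_ge0.
rewrite -natr1; have : 0 <= n%:R * x * x by rewrite !mulr_ge0.
by lra.
Qed.

Section Correctness.
Variables (R : realType) (k : nat) (beta : R) (sigma : strategy k) (s : term).
Variable q : nat -> rat.
Hypothesis k_gt0 : (0 < k)%N.
Hypothesis beta_gt1 : 1 < beta.
Hypothesis beta_ltk : beta < k%:R.
Hypothesis qP : forall n, `|beta - ratr (q n)| <= 2 ^- n.
Hypothesis sP : forall v, alive sigma v ->
  exists p m, [/\ evals_to (App s (enc_vertex v)) (enc_pair p m),
                  decides p (sigma v) &
                  modulus_of_convergence beta v m (sigma v)].
Implicit Types (u v w : vertex k).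

Lemma decider_evals v u : alive sigma v ->
  evals_to (App (decider s (nat_seq v)) (code (nat_seq u)))
           (enc_bool `[< sigma v u >]).
Proof.
move=> /sP[p [m [hs hp _]]]; rewrite -enc_vertexE /decider /strategy_output.
by rewrite -enc_vertexE (evalfE hs); exact: hp.
Qed.

Lemma modulus_evals v M : alive sigma v -> (0 < M)%N -> exists2 N : int,
  evals_to (App (modulus s (nat_seq v)) (enc_inv M)) (enc_int N) &
  (weight beta v (sigma v `&` [set u | (N < (size u)%:Z - (size v)%:Z)%R])
     < (M%:R^-1)%:E)%E.
Proof.
move=> /sP[p [m [hs _ hm]]] M0; rewrite enc_invE // /modulus /strategy_output.
rewrite -enc_vertexE (evalfE hs) /=.
have [|N hN wN] := hm (M%:R^-1); first by rewrite invr_gt0 ltr0n.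
by exists N => //; move: wN; rewrite fmorphV /= ratr_nat.
Qed.

Lemma in_forbiddenE v i u : alive sigma v ->
  in_forbidden s (nat_seq v) (nat_seq u) = `[< forbidden sigma (rcons v i) u >].
Proof.
move=> av; rewrite /in_forbidden prefixesE has_map size_map.
have E j : is_enc_true (evalf (App (decider s (take j (nat_seq v))) (code (nat_seq u))))
   = `[< sigma (take j v) u >].
  rewrite -map_take (evalfE (decider_evals u (alive_take av))) /enc_bool /=.
  by case: asboolP.
apply/hasP/asboolP => [[j]|].
  rewrite mem_iota add0n ltnS /= E => jv /asboolP su.
  by apply/forbidden_rcons; exists j.
move=> /forbidden_rcons[j jv su]; exists j; first by rewrite mem_iota add0n ltnS.
by rewrite /= E; apply/asboolP.
Qed.

Lemma forbidden_countE v i w j : alive sigma v ->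
  forbidden_count k s (nat_seq v) (nat_seq w) j =
  level_count (forbidden sigma (rcons v i)) w j.
Proof.
move=> av; elim: j w => [|j IH] w.
  rewrite /forbidden_count /= cats0 (in_forbiddenE i) // addn0.
  by case: asboolP.
rewrite /forbidden_count /= map_flatten sumn_flatten -!map_comp sumnE big_map.
rewrite -[X in iota 0 X]subn0 -/(index_iota 0 k) big_mkord; apply: eq_bigr => l _.
rewrite -IH /forbidden_count /= -map_comp; congr sumn; apply: eq_map => x /=.
by rewrite /nat_seq map_rcons cat_rcons.
Qed.

Lemma scaled_loadE v i w P S n : alive sigma v -> (0 < P)%N -> (0 < S)%N ->
  (scaled_load k s (nat_seq v) (nat_seq w) P S n)%:R =
  P%:R ^+ n * truncated_load (P%:R / S%:R : R) (forbidden sigma (rcons v i)) w n.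
Proof.
move=> av P0 S0; have P1 : P%:R != 0 :> R by rewrite pnatr_eq0 -lt0n.
elim: n => [|n IH].
  rewrite expr0 mul1r /truncated_load big_ord_recl big_ord0 addr0 expr0 invr1 mulr1.
  by rewrite [scaled_load _ _ _ _ _ _ _]/= (forbidden_countE i).
rewrite [scaled_load _ _ _ _ _ _ _]/= natrD !natrM IH (forbidden_countE i) //.
rewrite /truncated_load [in RHS]big_ord_recr mulrDr /= mulrA -exprS; congr (_ + _).
rewrite natrX -exprVn invfM invrK exprMn exprVn mulrCA mulVKf ?expf_neq0 //.
by rewrite mulrC.
Qed.

(** [tail_depth] is a sum over all prefixes, hence at least its summand for [take j v], which is at
    least [j + N] for the modulus answer [N] there. A deeper vertex is more than [N] levels below
    [take j v]. *)
Lemma tail_depthP v j M : alive sigma v -> (j <= size v)%N -> (0 < M)%N ->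
  (weight beta (take j v) (sigma (take j v) `&`
     [set u | (tail_depth s (nat_seq v) M < size u)%N]) <= (M%:R^-1)%:E)%E.
Proof.
move=> av jv M0; have [N hN wN] := modulus_evals (alive_take (j := j) av) M0.
apply: le_trans (ltW wN); apply: weight_sub => // u [su /= du]; split => //=.
have Nj : ((j + term_size (enc_int N))%N <= tail_depth s (nat_seq v) M)%N.
  rewrite /tail_depth prefixesE sumnE -map_comp big_map size_map.
  rewrite (bigD1_seq j) ?iota_uniq ?mem_iota ?add0n ?ltnS //=.
  rewrite -map_take (evalfE hN) size_map size_take_min (minn_idPl jv).
  exact: leq_addr.
have NN (z : int) : (z <= term_size (enc_int z))%R.
  case: z => n //=; rewrite ?add0n lez_nat.
  by rewrite (leq_trans (term_size_enc_nat n)) // -addn3 leq_addr.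
rewrite size_take_min (minn_idPl jv) ltrBrDr; apply: le_lt_trans (_ : _ < _)%R.
  by apply: lerD; [exact: NN|exact: lexx].
by rewrite -PoszD ltz_nat addnC (leq_ltn_trans Nj).
Qed.

Definition approx_num n := absz (numq (q n)).
Definition approx_den n := absz (denq (q n)).

Lemma approx_den_gt0 n : (0 < approx_den n)%N.
Proof. by rewrite /approx_den absz_gt0 denq_eq0. Qed.

Lemma expVn2_le1 n : 2 ^- n <= 1 :> R.
Proof. by rewrite invf_le1 ?exprn_gt0 // exprn_ege1 // ler1n. Qed.

Lemma ratr_approx n : ratr (q n) = (approx_num n)%:R / (approx_den n)%:R :> R.
Proof.
(* As [beta > 1] and the error is at most [1], the approximation is positive and taking absolute
   values loses nothing. *)
have q0 : 0 < q n.
  have := qP n; rewrite ler_distl => /andP[_ h]; rewrite -(ltr0q R).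
  by have := beta_gt1; have := expVn2_le1 n; lra.
rewrite /ratr /approx_num /approx_den.
by rewrite -[in LHS](gez0_abs (ltW (_ : 0 < numq (q n)))) ?numq_gt0 //
  -[in LHS](gez0_abs (ltW (denq_gt0 (q n)))).
Qed.

(** Lowering [q r.+1] by its error bound [2 ^- r.+1] gives a lower bound within
    [2 * 2 ^- r.+1 = 2 ^- r] of [beta]. As [beta > 1], this is also a bound on the relative
    error. *)
Lemma beta_approx r :
  let P := (approx_num r.+1 * 2 ^ r.+1 - approx_den r.+1)%N in
  let S := (approx_den r.+1 * 2 ^ r.+1)%N in
  [/\ (0 < P)%N, (0 < S)%N, P%:R / S%:R <= beta &
      beta * (1 - 2 ^- r) <= P%:R / S%:R].
Proof.
move=> P S; have d0 := approx_den_gt0 r.+1.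
have S0 : (0 < S)%N by rewrite muln_gt0 d0 expn_gt0.
have := qP r.+1; rewrite ratr_approx ler_distl => /andP[h1 h2].
have e2 : 2 ^- r = 2 * 2 ^- r.+1 :> R.
  by rewrite exprS invfM mulrA mulfV ?mul1r // pnatr_eq0.
have e1 := expVn2_le1 r.
have dR : 0 < (approx_den r.+1)%:R :> R by rewrite ltr0n.
have tR : 0 < 2 ^+ r.+1 :> R by rewrite exprn_gt0.
have bE : (approx_num r.+1)%:R / (approx_den r.+1)%:R - 2 ^- r.+1 =
   ((approx_num r.+1)%:R * 2 ^+ r.+1 - (approx_den r.+1)%:R) /
   ((approx_den r.+1)%:R * 2 ^+ r.+1) :> R.
  by field; rewrite !gt_eqF.
(* The real lower bound is positive, so the natural subtraction in [P] does not truncate. *)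
have lt : (approx_den r.+1 < approx_num r.+1 * 2 ^ r.+1)%N.
  rewrite -(ltr_nat R) natrM natrX -subr_gt0.
  rewrite -(pmulr_lgt0 _ (_ : 0 < ((approx_den r.+1)%:R * 2 ^+ r.+1)^-1 :> R)).
    by rewrite -bE; have := beta_gt1; lra.
  by rewrite invr_gt0 mulr_gt0.
have PS : P%:R / S%:R = (approx_num r.+1)%:R / (approx_den r.+1)%:R - 2 ^- r.+1 :> R.
  by rewrite bE /P /S natrB ?(ltnW lt) // !natrM natrX.
split => //; first by rewrite subn_gt0.
  by rewrite PS; lra.
have : 0 <= (beta - 1) * 2 ^- r by rewrite mulr_ge0 ?subr_ge0 ?invr_ge0 ?exprn_ge0 // ltW.
by rewrite PS; lra.
Qed.

Notation test := (light_test k s approx_num approx_den).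

Lemma light_testE v n (i : 'I_k) : alive sigma v -> i = (n %% k)%N :> nat ->
  let y := (nat_seq v, n) in
  let b := (beta_num k s approx_num approx_den y)%:R /
           (beta_den k s approx_den y)%:R : R in
  [/\ 0 < b, b <= beta,
    beta * (1 - 2 ^- (test_depth k s y + n)) <= b &
    test y = (truncated_load b (forbidden sigma (rcons v i)) (rcons v i)
                (test_depth k s y) * n.+1%:R < n%:R)].
Proof.
move=> av iE y b.
have [P0 S0 bb bb'] := beta_approx (test_depth k s y + n).
split => //; first by rewrite divr_gt0 // ltr0n.
rewrite /light_test -(ltr_nat R) !natrM natrX.
rewrite (_ : child k y = nat_seq (rcons v i)); last first.
  by rewrite /child /nat_seq map_rcons -iE.
rewrite (scaled_loadE i) // -mulrA [_%:R * _ ^+ _]mulrC ltr_pM2l //.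
by rewrite exprn_gt0 // ltr0n.
Qed.

(** The truncated load in base [beta] is at most that in base [b], hence below [n / (n + 1)], and
    the tail is at most [1 / (n + 1)]. *)
Lemma light_test_sound v n (i : 'I_k) : alive sigma v -> i = (n %% k)%N :> nat ->
  test (nat_seq v, n) ->
  (load beta (forbidden sigma (rcons v i)) (rcons v i) < 1)%E.
Proof.
move=> av iE; have [] := light_testE av iE.
set y := (nat_seq v, n); set b := (_ / _); set D := test_depth _ _ _.
move=> b0 bb _ -> T.
set w := rcons v i in T *; have M0 := tail_precision_gt0 k_gt0 y.
apply: le_lt_trans.
  apply: (@load_forbidden_le _ _ _ beta_gt1 sigma v i w D
     ((tail_precision k y)%:R^-1)) => // j jv.
  exact: tail_depthP.
rewrite lte_fin -/w.
have TT := truncated_load_ge beta_gt1 (forbidden sigma w) w D b0 bb.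
have n0 : 0 < n.+1%:R :> R by rewrite ltr0n.
have tail : (size w)%:R * (beta ^+ size w * (tail_precision k y)%:R^-1)
     <= n.+1%:R^-1 :> R.
  have sw : (0 < size w)%N by rewrite size_rcons.
  have -> : tail_precision k y = (n.+1 * (size w * k ^ size w))%N.
    by rewrite /tail_precision /child !size_rcons size_map.
  have kw : 0 < k%:R ^+ size w :> R by rewrite exprn_gt0 // ltr0n.
  have bk : beta ^+ size w <= k%:R ^+ size w.
    by apply: lerXn2r; rewrite ?nnegrE ?ler0n ?ltW // (lt_trans _ beta_gt1).
  rewrite !natrM natrX.
  have -> : (size w)%:R * (beta ^+ size w * (n.+1%:R * ((size w)%:R * k%:R ^+ size w))^-1)
     = n.+1%:R^-1 * (beta ^+ size w / k%:R ^+ size w) :> R.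
    by field; rewrite !gt_eqF // ltr0n.
  by rewrite ler_piMr ?invr_ge0 ?ler0n // ler_pdivrMr // mul1r.
rewrite -(ltr_pM2r n0) mul1r mulrDl.
apply: le_lt_trans (_ : truncated_load b (forbidden sigma w) w D * n.+1%:R + 1 < _).
  apply: lerD; first by rewrite ler_pM2r.
  by rewrite -ler_pdivlMr // mul1r.
by rewrite -[ltRHS]natr1 ltrD2r.
Qed.

(** For a load [L < 1], the computed value [T] is at most [L * (n + 1) / n]. The test therefore
    succeeds as soon as [L * (n + 1) ^ 2 < n ^ 2], which holds for large [n]. *)
Lemma light_test_complete v (i : 'I_k) : alive sigma v ->
  (load beta (forbidden sigma (rcons v i)) (rcons v i) < 1)%E ->
  exists n, test (nat_seq v, n).
Proof.
move=> av; set w := rcons v i; set A := forbidden sigma w.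
have L0 := load_ge0 beta_gt1 A w.
move=> L1; have [L LE] : exists L, load beta A w = L%:E.
  by case: (load beta A w) L0 L1 => [L||] // _ _; exists L.
rewrite LE lte_fin in L1; rewrite LE lee_fin in L0.
(* The constant [3] suffices: for [n > 1], [(1 - L) * n > 3] gives
   [(1 - L) * n ^ 2 > 3 * n > 2 * n + 1], whence [L * (n + 1) ^ 2 < n ^ 2]. *)
have [n0 n0P] : exists n0 : nat, 3 < (1 - L) * n0%:R.
  have c0 : 0 <= 3 / (1 - L) by rewrite divr_ge0 ?subr_ge0 // ltW.
  exists (Num.Def.archi_bound (3 / (1 - L))).
  by have := archi_boundP c0; rewrite ltr_pdivrMr ?subr_gt0 // mulrC.
(* A large precision that selects the child [i]. *)
pose n := (n0 * k + i)%N; exists n.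
have iE : i = (n %% k)%N :> nat by rewrite modnMDl modn_small.
have [] := light_testE av iE; set b := (_ / _); set D := test_depth _ _ _.
move=> b_gt0 b_le b_ge ->; rewrite -/w -/A.
have n_gt : 3 < (1 - L) * n%:R.
  apply: lt_le_trans n0P _; apply: ler_wpM2l; first by rewrite subr_ge0 ltW.
  by rewrite ler_nat /n (leq_trans (leq_pmulr _ k_gt0)) // leq_addr.
have n_gt1 : 1 < n%:R :> R by nra.
set T := truncated_load _ _ _ _.
have T_le : T <= (beta / b) ^+ D * L.
  apply: le_trans (truncated_load_le beta_gt1 _ _ _ b_gt0 b_le) _.
  apply: ler_wpM2l; first by rewrite exprn_ge0 // divr_ge0 // ltW // (lt_trans _ beta_gt1).
  by rewrite -lee_fin -LE; exact: truncated_load_le_load.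
(* By Bernoulli's inequality the relative error [2 ^- (D + n)] costs at most [D * 2 ^- (D + n)] over
   [D] levels; [2 ^ D] absorbs [D], and [2 ^ n >= n + 1]. *)
have x_ge : n%:R / n.+1%:R <= (b / beta) ^+ D.
  have b1 : 1 - 2 ^- (D + n) <= b / beta.
    by rewrite ler_pdivlMr ?(lt_trans _ beta_gt1) // mulrC.
  have e1 := expVn2_le1 (D + n).
  have e0 : 0 <= 2 ^- (D + n) :> R by rewrite invr_ge0 exprn_ge0.
  apply: (@le_trans _ _ ((1 - 2 ^- (D + n)) ^+ D)); last first.
    by apply: lerXn2r => //; rewrite nnegrE ?subr_ge0 // (le_trans _ b1) ?subr_ge0.
  apply: le_trans (bernoulli D _); last by rewrite e0 e1.
  have De : D%:R * 2 ^- (D + n) <= n.+1%:R^-1 :> R.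
    rewrite exprD invfM mulrA -[leRHS]mul1r; apply: ler_pM.
    - by rewrite mulr_ge0 // invr_ge0 exprn_ge0.
    - by rewrite invr_ge0 exprn_ge0.
    - rewrite ler_pdivrMr ?exprn_gt0 // mul1r -natrX ler_nat ltnW //.
      exact: ltn_expl.
    - rewrite lef_pV2 ?posrE ?exprn_gt0 ?ltr0n // -natrX ler_nat.
      exact: ltn_expl.
  have -> : n%:R / n.+1%:R = 1 - n.+1%:R^-1 :> R.
    by rewrite -natr1; field; rewrite natr1 pnatr_eq0.
  by rewrite lerB.
have bb_gt0 : 0 < (b / beta) ^+ D.
  by rewrite exprn_gt0 // divr_gt0 // (lt_trans _ beta_gt1).
have TL : T * (b / beta) ^+ D <= L.
  by rewrite -ler_pdivlMr // mulrC -exprVn invf_div.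
have T_ge0 : 0 <= T.
  by apply: sumr_ge0 => j _; rewrite mulr_ge0 // invr_ge0 exprn_ge0 // ltW.
have : T * (n%:R / n.+1%:R) <= L.
  by apply: le_trans TL; exact: ler_wpM2l.
have S_gt0 : 0 < n.+1%:R :> R by rewrite ltr0n.
rewrite mulrA ler_pdivrMr // => TnL.
have : T * n.+1%:R * n%:R <= L * n.+1%:R * n.+1%:R.
  by rewrite mulrAC ler_pM2r.
move: TnL; rewrite -natr1 => TnL TnL2.
rewrite -(ltr_pM2r (_ : 0 < n%:R)) ?(lt_trans _ n_gt1) //.
apply: le_lt_trans TnL2 _.
by nra.
Qed.

Lemma light_test_computable :
  computable_on xpredT (fun n => (numq (q n), denq (q n))) ->
  computable_on (fun y => exists2 v, y.1 = nat_seq v & alive sigma v) test.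
Proof.
move=> q_computable.
apply: (@computable_light_test _ _ _ _
  (fun x => exists2 v, x = nat_seq v & alive sigma v)) => //.
- move=> _ j [v -> av]; exists (take j v); last exact: alive_take.
  by rewrite /nat_seq map_take.
- move=> _ [v -> /sP[p [m [h _ _]]]]; exists (enc_pair p m).
  by rewrite -enc_vertexE.
- move=> _ u [v -> av] uk.
  (* All entries of [u] are below [k], so the default ordinal is never taken and [u] represents a
     vertex. *)
  have -> : u = nat_seq [seq insubd (Ordinal k_gt0) j | j <- u].
    rewrite /nat_seq -map_comp map_id_in // => j /(allP uk) jk /=.
    by rewrite val_insubd (jk : (j < k)%N).
  by eexists; exact: decider_evals.
- move=> _ M [v -> av] M0; have [N h _] := modulus_evals av M0.
  by eexists; exact: h.
- by apply: computable_on_absz; exact: (computable_on_fst q_computable).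
- by apply: computable_on_absz; exact: (computable_on_snd q_computable).
- by move=> _ [v -> _]; apply/allP => _ /mapP[i _ ->] /=.
Qed.

End Correctness.

(** * Bob's computable winning path *)

Theorem theorem2 (R : realType) (k : nat) (beta omega : R) (sigma : strategy k)
  (k_gt1 : (1 < k)%N)
  (beta_gt1 : 1 < beta) (beta_ltk : beta < k%:R)
  (omega_gt0 : 0 < omega)
  (beta_computable : computable_real beta)
  (omega_computable : computable_real omega)
  (beta_omega : beta * (1 + omega) <= k%:R)
  (sigma_legal : legal_strategy beta omega sigma)
  (sigma_computable : computable_strategy beta sigma) :
  exists2 path : nat -> 'I_k, computable_path path & Bob_wins sigma path.
Proof.
have k_gt0 : (0 < k)%N by exact: ltnW.
case: beta_computable => q [pq cpq hpq] qP; case: sigma_computable => s cs sP.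
have q_computable : computable_on xpredT (fun n => (numq (q n), denq (q n))).
  (* The program [pq] is closed but perhaps not an abstraction; eta-expansion makes it a value. *)
  exists (Lam (App pq (Var 0))).
    by rewrite /is_value /closed_term /= (closed_below_le _ cpq).
  move=> n _; apply: evals_to_beta; first exact: codeP.
  by rewrite /= (subst_closed _ cpq) //; exact: hpq.
pose test := light_test k s (approx_num q) (approx_den q).
have test_computable := light_test_computable k_gt0 sP q_computable.
pose light x := exists v, [/\ x = nat_seq v, alive sigma v &
  (load beta (forbidden sigma v) v < 1)%E].
have light_test_exists x : light x -> exists n, test (x, n).
  move=> [v [-> av lv]].
  have [i li] := legal_light_child beta_gt1 beta_omega sigma_legal av lv.
  exact: (light_test_complete k_gt0 beta_gt1 qP sP av li).
(* The default [0] is never taken at light positions, where some test succeeds. *)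
pose search x := if pselect (exists n, test (x, n)) is left h then ex_minn h else 0%N.
have search_computable : computable_on light search.
  apply: (@computable_on_search _ _ (fun x n => test (x, n))).
    move=> x lx; rewrite /search; case: pselect => [h|[]]; last exact: light_test_exists.
    case: ex_minnP => m tm mmin; split => // n nm; apply/negP => /mmin.
    by rewrite leqNgt nm.
  apply: computable_on_weaken test_computable; last by case.
  by move=> y [v [-> av _]]; exists v.
(* Positions are built as lists of numbers, independently of [path], so that recursion on [n]
   computes them. *)
pose position := fix position n :=
  if n is m.+1 then rcons (position m) (search (position m) %% k)%N else [::].
pose path n : 'I_k := Ordinal (ltn_pmod (search (position n)) k_gt0).
have positionE n : position n = nat_seq (mkseq path n).
  by elim: n => // n IH; rewrite mkseqS /nat_seq map_rcons -/(nat_seq _) -IH.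
have alive_light n : alive sigma (mkseq path n) /\
    (load beta (forbidden sigma (mkseq path n)) (mkseq path n) < 1)%E.
  elim: n => [|n [av lv]].
    (* Before Alice's first move nothing is forbidden, so the root has load [0]. *)
    have f0 : forbidden sigma [::] = set0 by apply/seteqP; split => // u [].
    split; first by case=> // _; rewrite /= f0.
    by rewrite f0 /load set0I /weight esum_set0 lte_fin.
  rewrite mkseqS.
  have lc : (load beta (forbidden sigma (rcons (mkseq path n) (path n)))
       (rcons (mkseq path n) (path n)) < 1)%E.
    apply: (@light_test_sound _ _ _ _ _ _ k_gt0 beta_gt1 beta_ltk qP sP _
      (search (position n)) (path n) av) => //.
    rewrite -positionE /path /= /search; case: pselect => [h|[]].
      by case: ex_minnP.
    by apply: light_test_exists; exists (mkseq path n); rewrite -positionE.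
  by split => //; apply: alive_rcons lc.
have light_position n : light (position n).
  by have [av lv] := alive_light n; exists (mkseq path n).
have position_computable : computable_on xpredT position.
  apply: (@computable_on_nat_rec nat_code (seq_code nat_code) xpredT (fun n => n)
    (fun _ n => position n) (fun y => rcons y.2.2 (search y.2.2 %% k)%N)) => //.
  - exact: computable_on_id.
  - exact: computable_on_const.
  apply: computable_on_rcons; first by compute_on.
  apply: computable_on_modn => //.
  (* The search is known to terminate only at light positions; the recursion principle guarantees
     that the intermediate value is a genuine [position], which is light. *)
  apply: (computable_on_comp (f := fun y => y.2.2) search_computable).
    by compute_on.
  by move=> y [_ _ ->].
exists path.
  have [p vp hp] : computable_on xpredT (fun n => (search (position n) %% k)%N).
    apply: computable_on_modn => //.
    exact: (computable_on_comp search_computable position_computable).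
  by exists p; [exact: value_closed | move=> n; exact: hp].
move=> n; have [av _] := alive_light n.
by have := av _ (leqnn _); rewrite take_size.
Qed.
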